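(* Let $n\ge 2$ be an integer and let $f:(0,\infty)\to\mathbb{R}$ be a continuous and (strictly) increasing function. If $G_n\in\mathcal{G}_n$ is a maximum point of $E^f_n$ on $\mathcal{G}_n$, i.e. $E^f_n(G_n)\ge E^f_n(G_n')$ for all $G_n'\in\mathcal{G}_n$, then $G_n$ is a convex $n$-gon (possibly degenerate) with each edge of length $1$.
   Context: $\mathcal{G}_n$ is the set of all non-extensible flexible closed curves $G_n$ of length $n$ in $\mathbb{R}^3$ carrying $n$ particles (called vertices) $A_1,\dots,A_n$ evenly fixed along the curve with respect to arc length. Explicitly, $G_n$ is given by an $n$-periodic map $c:\mathbb{R}\to\mathbb{R}^3$ parametrized by arc length (the length of $c|_{[s,t]}$ is $t-s$ for all $s<t$), and $A_i=c(i)$. Indices are cyclic, $A_{n+1}=A_1$. The vertex positions that occur are exactly the tuples $(A_1,\dots,A_n)\in(\mathbb{R}^3)^n$ with $|A_iA_{i+1}|\le 1$ for all $i$ (cyclically), where $|A_pA_q|$ is the Euclidean distance. The energy is $E^f_n(G_n)=\sum_{1\le p<q\le n} f(|A_pA_q|)$, which depends only on the vertex positions. Vertices may coincide; the value $f(0)$ is understood as $\lim_{x\to 0^+}f(x)\in[-\infty,\infty)$, so that $E^f_n$ takes values in $[-\infty,\infty)$. A convex $n$-gon (possibly degenerate) with each edge of length $1$ is a closed polygon with vertices $A_1,\dots,A_n$, all lying in one plane, with straight edges $A_iA_{i+1}$ satisfying $|A_iA_{i+1}|=1$ for all $i$ (cyclically), such that, with $C$ the convex hull of $\{A_1,\dots,A_n\}$,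 the points $A_1,\dots,A_n$ all lie on the boundary closed curve $\partial C$ and occur on it in this cyclic order during a single traversal of $\partial C$. Interior angles equal to $\pi$ are allowed. In the degenerate case, where all $A_i$ are collinear, $C$ is a segment with endpoints $P_1,P_2$, and $\partial C$ is understood as the closed curve going along the segment from $P_1$ to $P_2$ and then back from $P_2$ to $P_1$. *)

(* Defs.v *)
From HB Require Import structures.
From mathcomp Require Import all_boot all_order all_algebra.
From mathcomp Require Import all_classical all_reals all_analysis.

Set Implicit Arguments.
Unset Strict Implicit.
Unset Printing Implicit Defensive.

Import Order.TTheory GRing.Theory Num.Theory.
Import numFieldNormedType.Exports.

Local Open Scope classical_set_scope.
Local Open Scope ring_scope.

Section Flexible_polygons.
Context {R : realType}.

(* The topology of [point3] is the usual one, but its library norm is the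
   sup norm, hence the explicit Euclidean distance. *)
Definition point3 := 'rV[R]_3.

Definition dist (P Q : point3) : R :=
  Num.sqrt (\sum_(i < 3) (P 0 i - Q 0 i) ^+ 2).

(* Supremum of the lengths of inscribed polygonal lines, following
   [total_variation]. *)
Definition curve_length (c : R -> point3) (a b : R) : \bar R :=
  ereal_sup [set (let F := c \o nth b (a :: l) in
                  \sum_(0 <= k < size l) dist (F k) (F k.+1))%:E
            | l in itv_partition a b].

Definition flexible_curve (n : nat) (c : R -> point3) : Prop :=
  periodic c n%:R /\
  forall s t : R, s < t -> curve_length c s t = (t - s)%:E.

(* The vertices are [vertex c 1], ..., [vertex c n]; by periodicity
   [vertex c n.+1] is [vertex c 1]. *)
Definition vertex (c : R -> point3) (i : nat) : point3 := c i%:R.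

(* [f] on the positive reals, extended to 0 by its right limit there. *)
Definition extend0 (f : R -> R) (x : R) : \bar R :=
  if x == 0 then lim ((f y)%:E @[y --> 0^'+]) else (f x)%:E.

Definition energy (f : R -> R) (n : nat) (c : R -> point3) : \bar R :=
  (\sum_(1 <= p < n.+1) \sum_(p.+1 <= q < n.+1)
     extend0 f (dist (vertex c p) (vertex c q)))%E.

Definition energy_maximizer (f : R -> R) (n : nat) (c : R -> point3) : Prop :=
  flexible_curve n c /\
  forall c', flexible_curve n c' -> (energy f n c' <= energy f n c)%E.

Definition segment_pt (P Q : point3) (t : R) : point3 := (1 - t) *: P + t *: Q.

Definition segment (P Q : point3) : set point3 :=
  [set segment_pt P Q t | t in `[0, 1]].

Definition convex_hull (X : set point3) : set point3 :=
  smallest (@convex_set R point3) X.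

Definition collinear (X : set point3) : Prop :=
  exists P v : point3, X `<=` [set P + t *: v | t in [set: R]].

Definition is_plane (H : set point3) : Prop :=
  exists P u v : point3, free [:: u; v] /\
    H = [set P + x.1 *: u + x.2 *: v | x in [set: R * R]].

(* Topological boundary of [C] relative to [H], for [C] inside a closed [H]. *)
Definition boundary_in (H C : set point3) : set point3 :=
  closure C `&` closure (H `\` C).

(* [g], of period 1, runs along the boundary of the compact convex set [C] of
   the plane [H] exactly once per period. If [C] is a segment, its boundary is
   that segment run along in one direction and then in the other. *)
Definition boundary_traversal (H C : set point3) (g : R -> point3) : Prop :=
  periodic g 1 /\
  ([/\ ~ collinear C, continuous g, {in `[0, 1[ &, injective g} &
       range g = boundary_in H C] \/
   exists P1 P2 : point3, C = segment P1 P2 /\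
     forall s : R, 0 <= s <= 1 / 2 ->
       g s = segment_pt P1 P2 (2 * s) /\ g (1 - s) = segment_pt P1 P2 (2 * s)).

Definition in_cyclic_order (n : nat) (A : nat -> point3) (g : R -> point3) : Prop :=
  exists t : nat -> R,
    [/\ forall i, (1 <= i < n)%N -> t i < t i.+1,
        t n < t 1%N + 1 &
        forall i, (1 <= i <= n)%N -> g (t i) = A i].

Definition convex_unit_ngon (n : nat) (c : R -> point3) : Prop :=
  let A := vertex c in
  let V := [set A i | i in [set i | (1 <= i <= n)%N]] in
  [/\ forall i, (1 <= i <= n)%N -> dist (A i) (A i.+1) = 1,
      forall i (u : R), (1 <= i <= n)%N -> 0 <= u <= 1 ->
        c (i%:R + u) = segment_pt (A i) (A i.+1) u &
      exists H, [/\ is_plane H, V `<=` H &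
        exists g, boundary_traversal H (convex_hull V) g /\
                  in_cyclic_order n A g]].

End Flexible_polygons.

Arguments point3 R : clear implicits.

(* Main.v *)
(** Seen from a point O off the vertices, let Theta(O) be the sum of the angles
    A_i O A_(i+1). If Theta(O) = 2 pi, the triangles O A_i A_(i+1) unfold side
    by side into the plane around O; edges keep their length, and chords do not
    shrink because an angle A_p O A_q is at most the sum of the turns on either
    arc. So a maximizer is congruent to each of its unfoldings: its vertices
    wind monotonically once around every O with Theta(O) = 2 pi, and such an O
    does not see them in an open half-space.

    On an edge, Theta >= 2 pi; along a ray to infinity Theta tends to 0, so by
    the intermediate value theorem Theta = 2 pi somewhere on the ray. A generic
    ray gives planarity. A ray normal to the plane of the polygon must stop at
    its origin, so Theta = 2 pi on the edges: from any edge point the other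
    vertices are seen in order over a half turn, which is convexity. Just off
    the plane Theta < 2 pi, which leaves room to open a turn and lengthen any
    edge shorter than 1. *)

Require Import Defs.
From HB Require Import structures.
From mathcomp Require Import all_boot all_order all_algebra.
From mathcomp Require Import all_classical all_reals all_analysis.
From mathcomp Require Import ring lra zify.

Set Implicit Arguments.
Unset Strict Implicit.
Unset Printing Implicit Defensive.

Import Order.TTheory GRing.Theory Num.Theory.
Import numFieldNormedType.Exports.

Local Open Scope classical_set_scope.
Local Open Scope ring_scope.

(** * Euclidean space and angles *)

Section Euclidean.
Context {R : realType}.
Implicit Types (a b c u v w : point3 R) (k x y : R).

(** The energy enters only through the rigidity property [tight]. Extracting it needs a maximum
    above [-oo]: when [f(0)] is [-oo], one coincidence of vertices would absorb every gain
    elsewhere. Every point O has to avoid the vertices, where angles lose their meaning, so edge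
    points and rays are chosen to miss finitely many positions. Convexity is proved edge by edge:
    each edge has all vertices on one side, in order of polar angle, and the convex hull is
    identified with the intersection of these half-planes. Interior angles [pi] are the obstacle
    there, because a side may then consist of several edges in a row, and order statements hold only
    weakly. A collinear polygon has no inner side at all; it is treated apart, by counting half
    turns seen from a point of an edge. *)

Definition dot a b : R := \sum_(i < 3) a 0 i * b 0 i.

Lemma dotC a b : dot a b = dot b a.
Proof. by apply: eq_bigr => i _; rewrite mulrC. Qed.

Lemma dotDl a b c : dot (a + b) c = dot a c + dot b c.
Proof. by rewrite /dot -big_split; apply: eq_bigr => i _; rewrite mxE mulrDl. Qed.

Lemma dotZl k a b : dot (k *: a) b = k * dot a b.
Proof. by rewrite /dot mulr_sumr; apply: eq_bigr => i _; rewrite mxE mulrA. Qed.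

Lemma dotNl a b : dot (- a) b = - dot a b.
Proof. by rewrite -scaleN1r dotZl mulN1r. Qed.

Lemma dotDr a b c : dot c (a + b) = dot c a + dot c b.
Proof. by rewrite dotC dotDl !(dotC c). Qed.

Lemma dotZr k a b : dot a (k *: b) = k * dot a b.
Proof. by rewrite dotC dotZl dotC. Qed.

Lemma dotNr a b : dot a (- b) = - dot a b.
Proof. by rewrite dotC dotNl dotC. Qed.

Lemma dot0l a : dot 0 a = 0.
Proof. by rewrite -(scale0r 0) dotZl mul0r. Qed.

Lemma dot0r a : dot a 0 = 0.
Proof. by rewrite dotC dot0l. Qed.

Definition dotE := (dotDl, dotDr, dotNl, dotNr, dotZl, dotZr, dot0l, dot0r).

Lemma sum3E (F : 'I_3 -> R) : \sum_(i < 3) F i = F 0 + F 1 + F 2%:R.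
Proof.
rewrite !big_ord_recl big_ord0 addr0 addrA.
by congr (F _ + F _ + F _); apply/val_inj.
Qed.

Lemma dot3E a b :
  dot a b = a 0 0 * b 0 0 + a 0 1 * b 0 1 + a 0 2%:R * b 0 2%:R.
Proof. exact: sum3E. Qed.

Lemma dot_ge0 a : 0 <= dot a a.
Proof. by apply: sumr_ge0 => i _; rewrite -expr2 sqr_ge0. Qed.

Lemma dot_eq0 a : (dot a a == 0) = (a == 0).
Proof.
apply/idP/eqP => [|->]; last by rewrite dot0l.
rewrite psumr_eq0 => [/allP h|i _]; last by rewrite -expr2 sqr_ge0.
apply/rowP => i; rewrite mxE; apply/eqP.
by have := h i (mem_index_enum _); rewrite mulf_eq0 orbb.
Qed.

Lemma dot_gt0 a : (0 < dot a a) = (a != 0).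
Proof. by rewrite lt_def dot_ge0 andbT dot_eq0. Qed.

Definition nrm a : R := Num.sqrt (dot a a).

Lemma nrm_ge0 a : 0 <= nrm a.
Proof. exact: sqrtr_ge0. Qed.

Lemma nrm_sqr a : nrm a ^+ 2 = dot a a.
Proof. by rewrite sqr_sqrtr // dot_ge0. Qed.

Lemma nrm_gt0 a : (0 < nrm a) = (a != 0).
Proof. by rewrite sqrtr_gt0 dot_gt0. Qed.

Lemma nrm_eq0 a : (nrm a == 0) = (a == 0).
Proof. by rewrite -sqrf_eq0 nrm_sqr dot_eq0. Qed.

Lemma nrmZ k a : nrm (k *: a) = `|k| * nrm a.
Proof.
by rewrite /nrm dotZl dotZr mulrA -expr2 sqrtrM ?sqr_ge0// sqrtr_sqr.
Qed.

Lemma nrmN a : nrm (- a) = nrm a.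
Proof. by rewrite /nrm dotNl dotNr opprK. Qed.

Lemma CauchySchwarz_sqr a b : dot a b ^+ 2 <= dot a a * dot b b.
Proof.
have [->|a0] := eqVneq a 0; first by rewrite !dot0l expr0n mul0r.
have : 0 <= dot (dot a a *: b - dot a b *: a) (dot a a *: b - dot a b *: a).
  exact: dot_ge0.
rewrite !dotE (dotC b a).
rewrite [X in 0 <= X](_ : _ = dot a a * (dot a a * dot b b - dot a b ^+ 2));
  last by ring.
by rewrite pmulr_rge0 ?dot_gt0// subr_ge0.
Qed.

Lemma CauchySchwarz a b : `|dot a b| <= nrm a * nrm b.
Proof.
rewrite -(@ler_pXn2r _ 2) ?nnegrE ?mulr_ge0 ?nrm_ge0//.
by rewrite exprMn !nrm_sqr real_normK ?num_real// CauchySchwarz_sqr.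
Qed.

Lemma dot_le_nrm a b : dot a b <= nrm a * nrm b.
Proof. exact: le_trans (ler_norm _) (CauchySchwarz _ _). Qed.

Lemma nrmD a b : nrm (a + b) <= nrm a + nrm b.
Proof.
rewrite -(@ler_pXn2r _ 2) ?nnegrE ?addr_ge0 ?nrm_ge0//.
rewrite nrm_sqr sqrrD !nrm_sqr !dotE (dotC b a).
have := dot_le_nrm a b; lra.
Qed.

Lemma distE a b : dist a b = nrm (a - b).
Proof.
by rewrite /dist /nrm; congr Num.sqrt; apply: eq_bigr => i _; rewrite !mxE expr2.
Qed.

Lemma distC a b : dist a b = dist b a.
Proof. by rewrite !distE -nrmN opprB. Qed.

Lemma dist_ge0 a b : 0 <= dist a b.
Proof. by rewrite distE nrm_ge0. Qed.

Lemma dist_triangle b a c : dist a c <= dist a b + dist b c.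
Proof. by rewrite !distE -[a - c](subrKA b) nrmD. Qed.

Lemma dist_eq0 a b : (dist a b == 0) = (a == b).
Proof. by rewrite distE nrm_eq0 subr_eq0. Qed.

Definition vec3 x y z : point3 R :=
  \row_(i < 3) (if i == 0 then x else if i == 1 then y else z).

Lemma vec3E x y z :
  (vec3 x y z 0 0 = x) * (vec3 x y z 0 1 = y) * (vec3 x y z 0 2%:R = z).
Proof. by rewrite !mxE. Qed.

Lemma exists_dot0 a : exists2 b, dot b b = 1 & dot a b = 0.
Proof.
suff [b b0 ab0] : exists2 b, b != 0 & dot a b = 0.
  exists ((nrm b)^-1 *: b); last by rewrite dotZr ab0 mulr0.
  rewrite -nrm_sqr nrmZ ger0_norm ?invr_ge0 ?nrm_ge0//.
  by rewrite mulVf ?expr1n// nrm_eq0.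
have [a00|a00] := eqVneq (a 0 0) 0.
  exists (vec3 1 0 0); last by rewrite dot3E !vec3E a00; ring.
  by apply/eqP => /rowP /(_ 0); rewrite vec3E mxE => /eqP; rewrite oner_eq0.
exists (vec3 (- a 0 1) (a 0 0) 0); last by rewrite dot3E !vec3E; ring.
by apply/eqP => /rowP /(_ 1); rewrite vec3E mxE => /eqP; rewrite (negPf a00).
Qed.

Definition orthonormal2 u v := [/\ dot u u = 1, dot v v = 1 & dot u v = 0].

Lemma exists_normal u v : orthonormal2 u v ->
  exists N, [/\ dot N N = 1, dot u N = 0 & dot v N = 0].
Proof.
move=> [uu vv uv].
exists (vec3 (u 0 1 * v 0 2%:R - u 0 2%:R * v 0 1)
  (u 0 2%:R * v 0 0 - u 0 0 * v 0 2%:R) (u 0 0 * v 0 1 - u 0 1 * v 0 0)).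
split; last 2 first.
- by rewrite dot3E !vec3E; ring.
- by rewrite dot3E !vec3E; ring.
transitivity (dot u u * dot v v - dot u v ^+ 2).
  by rewrite !dot3E !vec3E; ring.
by rewrite uu vv uv; ring.
Qed.

End Euclidean.

(** * Angles between vectors: spherical triangle inequality and continuity *)

Section Angles.
Context {R : realType}.
Implicit Types (a b c u v w : point3 R) (k x y : R).

(** A zero argument gives the quotient 0, hence a right angle; the bounds and [dot_ang] survive this
    convention. *)
Definition ang a b : R := acos (dot a b / (nrm a * nrm b)).

Lemma cos_ang_itv a b : -1 <= dot a b / (nrm a * nrm b) <= 1.
Proof.
rewrite -ler_norml normrM normfV [`|nrm a * _|]ger0_norm ?mulr_ge0 ?nrm_ge0//.
have [->|n0] := eqVneq (nrm a * nrm b) 0; first by rewrite invr0 mulr0.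
by rewrite ler_pdivrMr ?mul1r ?CauchySchwarz// lt_def n0 mulr_ge0 ?nrm_ge0.
Qed.

Lemma ang_ge0 a b : 0 <= ang a b.
Proof. exact/acos_ge0/cos_ang_itv. Qed.

Lemma ang_lepi a b : ang a b <= pi.
Proof. exact/acos_lepi/cos_ang_itv. Qed.

Lemma angC a b : ang a b = ang b a.
Proof. by rewrite /ang dotC mulrC (mulrC (nrm b)) mulrC. Qed.

Lemma dot_ang a b : dot a b = nrm a * nrm b * cos (ang a b).
Proof.
rewrite acosK; last by rewrite in_itv/= cos_ang_itv.
have [->|a0] := eqVneq a 0; first by rewrite /nrm !dot0l sqrtr0 !mul0r.
have [->|b0] := eqVneq b 0; first by rewrite /nrm !dot0r sqrtr0 mulr0 !mul0r.
by rewrite mulrC divfK// mulf_neq0 ?nrm_eq0.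
Qed.

Lemma le_cos x y : 0 <= x -> x <= y -> y <= pi -> cos y <= cos x :> R.
Proof.
move=> x0 xy ypi; rewrite leNgt ltr_cos ?in_itv/= ?x0 ?ypi ?(le_trans xy)//.
- by rewrite -leNgt.
- by rewrite (le_trans x0 xy).
Qed.

Lemma ang_le_of_cos a b x : a != 0 -> b != 0 -> 0 <= x -> x <= pi ->
  nrm a * nrm b * cos x <= dot a b -> ang a b <= x.
Proof.
move=> a0 b0 x0 xpi; rewrite dot_ang ler_pM2l; last first.
  by rewrite mulr_gt0 ?nrm_gt0.
apply: contraTT; rewrite -!ltNge => lt.
by rewrite ltr_cos ?in_itv/= ?x0 ?xpi ?ang_ge0 ?ang_lepi.
Qed.

(** Cauchy-Schwarz for the components of [a] and [c] orthogonal to [b]: their norms carry the sines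
    of the cosine addition formula. *)
Lemma ang_triangle b a c : a != 0 -> b != 0 -> c != 0 ->
  ang a c <= ang a b + ang b c.
Proof.
move=> a0 b0 c0.
have [h|/ltW h] := leP pi (ang a b + ang b c).
  exact: le_trans (ang_lepi _ _) h.
apply: ang_le_of_cos => //; first by rewrite addr_ge0 ?ang_ge0.
have nb : 0 < nrm b ^+ 2 by rewrite exprn_gt0 ?nrm_gt0.
rewrite -(ler_pM2l nb) cosD.
have sin_ge0 p q : 0 <= sin (ang p q) :> R.
  by rewrite sin_ge0_pi// ang_ge0 ang_lepi.
(* Components orthogonal to [b], multiplied by [nrm b ^+ 2] to avoid a division. *)
pose a' := nrm b ^+ 2 *: a - dot a b *: b.
pose c' := nrm b ^+ 2 *: c - dot b c *: b.
have na' : nrm a' = nrm a * nrm b ^+ 2 * sin (ang a b).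
  rewrite [LHS]/nrm -[RHS]ger0_norm ?mulr_ge0 ?sqr_ge0 ?nrm_ge0// -sqrtr_sqr.
  congr Num.sqrt; rewrite exprMn sin2cos2 /a' !dotE -(nrm_sqr a) -(nrm_sqr b).
  by rewrite (dotC b a) (dot_ang a b); ring.
have nc' : nrm c' = nrm c * nrm b ^+ 2 * sin (ang b c).
  rewrite [LHS]/nrm -[RHS]ger0_norm ?mulr_ge0 ?sqr_ge0 ?nrm_ge0// -sqrtr_sqr.
  congr Num.sqrt; rewrite exprMn sin2cos2 /c' !dotE -(nrm_sqr c) -(nrm_sqr b).
  by rewrite (dotC c b) (dot_ang b c); ring.
have := dot_le_nrm (- a') c'; rewrite nrmN na' nc' dotNl.
rewrite {1}/a' {1}/c' !dotE -(nrm_sqr b) (dot_ang a b) (dot_ang b c) => H.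
rewrite -(ler_pM2l nb); move: H.
set X := (X in - X <= _ -> _); set Y := (Y in _ <= Y -> _) => H.
set Z := nrm b ^+ 2 *
  (nrm a * nrm b * cos (ang a b) * (nrm b * nrm c * cos (ang b c))).
rewrite [leRHS](_ : _ = X + Z); last by rewrite /X /Z; ring.
rewrite [leLHS](_ : _ = - Y + Z); last by rewrite /Y /Z; ring.
by rewrite lerD2r lerNl.
Qed.

Lemma angZ k a b : 0 < k -> ang (k *: a) (k *: b) = ang a b.
Proof.
move=> k0; rewrite /ang !nrmZ !dotZl !dotZr gtr0_norm//; congr acos.
rewrite mulrACA mulrA invfM mulrACA [X in X * _]divff ?mul1r//.
by rewrite mulf_neq0 ?gt_eqF.
Qed.

Lemma angaa a : a != 0 -> ang a a = 0.
Proof.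
by move=> a0; rewrite /ang -expr2 nrm_sqr divff ?acos1// dot_eq0.
Qed.

Lemma ang_opp a k : a != 0 -> 0 < k -> ang a (- (k *: a)) = pi.
Proof.
move=> a0 k0; rewrite /ang nrmN nrmZ gtr0_norm// dotNr dotZr mulrCA -expr2.
by rewrite nrm_sqr mulNr divff ?acosN1// mulf_neq0 ?dot_eq0// gt_eqF.
Qed.

(** The endpoints -1 and 1 matter: a point on an edge sees it under the angle [pi]. Continuity there
    comes from [acos] being a decreasing surjection of [[-1, 1]] onto [[0, pi]]. *)
Lemma cvg_acos (T : Type) (F : set_system T) {FF : Filter F} (g : T -> R) (l : R) :
  (forall t, -1 <= g t <= 1) -> -1 <= l <= 1 ->
  g t @[t --> F] --> l -> acos (g t) @[t --> F] --> acos l.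
Proof.
move=> gI lI gl.
have : {within `[-1, 1], continuous (@acos R)}.
  rewrite -(@acosK R (-1)) ?in_itv/=; last by lra.
  rewrite -{2}(@acosK R 1) ?in_itv/=; last by lra.
  rewrite acosN1 acos1 cospi cos0.
  have N1E : (-1 : R) = cos pi by rewrite cospi.
  apply: segment_dec_surj_continuous => [x y xI yI|].
    rewrite -{2}(acosK xI) -{2}(acosK yI) !leNgt ltr_cos// in_itv/=.
    - by move: xI; rewrite in_itv/= => xI; rewrite acos_ge0// acos_lepi.
    - by move: yI; rewrite in_itv/= => yI; rewrite acos_ge0// acos_lepi.
  rewrite acosN1 acos1 => y /= yI; exists (cos y); last exact: cosK.
  by rewrite /= in_itv/= cos_geN1 cos_le1.
move=> /subspace_continuousP /(_ l); rewrite /= in_itv/= lI => /(_ isT) H A /H.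
rewrite /nbhs/= /within/= => /gl; rewrite /nbhs/=.
by apply: filterS => t; apply; rewrite in_itv/=.
Qed.

Lemma continuous_dot a b u v (t : R) :
  {for t, continuous (fun s : R => dot (a + s *: u) (b + s *: v))}.
Proof.
rewrite (_ : (fun s => _) = fun s : R =>
    dot a b + s * (dot a v + dot u b) + s * s * dot u v); last first.
  by apply/funext => s; rewrite !dotE; ring.
apply: cvgD; [apply: cvgD; [exact: cvg_cst|]|]; apply: cvgM; do ?exact: cvg_cst.
- exact: cvg_id.
- by apply: cvgM; exact: cvg_id.
Qed.

Lemma continuous_nrm a u (t : R) :
  {for t, continuous (fun s : R => nrm (a + s *: u))}.
Proof.
apply: (@continuous_comp _ _ _ (fun s : R => dot (a + s *: u) (a + s *: u)) Num.sqrt).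
  exact: continuous_dot.
exact: sqrt_continuous.
Qed.

Lemma continuous_ang a b u v (t : R) : a + t *: u != 0 -> b + t *: v != 0 ->
  {for t, continuous (fun s : R => ang (a + s *: u) (b + s *: v))}.
Proof.
move=> a0 b0; apply: cvg_acos => [s||]; do ?exact: cos_ang_itv.
apply: cvgM; first exact: continuous_dot.
apply: (@cvgV _ _ _ _ _ (nrm (a + t *: u) * nrm (b + t *: v))).
  by rewrite mulf_neq0 ?nrm_eq0.
by apply: cvgM; exact: continuous_nrm.
Qed.

End Angles.

(** * Unfolding a polygon around a point *)

Section Development.
Context {R : realType}.
Variables (n : nat) (n_gt0 : (0 < n)%N).
Implicit Types (a B : nat -> point3 R) (F beta : nat -> R).

Definition cyclic (T : Type) (F : nat -> T) := forall k, F (k + n)%N = F k.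

Lemma cyclicM (T : Type) (F : nat -> T) m k : cyclic F -> F (k + m * n)%N = F k.
Proof.
move=> cF; elim: m k => [|m IH] k; first by rewrite mul0n addn0.
by rewrite mulSn addnA IH cF.
Qed.

Lemma cyclic_mod (T : Type) (F : nat -> T) k : cyclic F -> F (k %% n)%N = F k.
Proof. by move=> cF; rewrite {2}(divn_eq k n) addnC cyclicM. Qed.

Lemma sum_cyclic F j : cyclic F ->
  \sum_(j <= k < j + n) F k = \sum_(0 <= k < n) F k.
Proof.
move=> cF; elim: j => [|j IH]; first by rewrite add0n.
rewrite -IH addSn big_nat_recr/= ?cF; last by lia.
by rewrite [RHS]big_ltn ?cF 1?addrC//; lia.
Qed.

Definition turn a k : R := ang (a k) (a k.+1).

Definition total_turn a : R := \sum_(0 <= k < n) turn a k.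

Lemma turn_cyclic a : cyclic a -> cyclic (turn a).
Proof. by move=> ca k; rewrite /turn -addSn !ca. Qed.

Definition psum beta k : R := \sum_(0 <= i < k) beta i.

Lemma psumB beta p q : (p <= q)%N ->
  psum beta q - psum beta p = \sum_(p <= i < q) beta i.
Proof. by move=> pq; rewrite /psum (@big_cat_nat _ _ _ p 0 q)//= [LHS]addrC addKr. Qed.

Lemma psumS beta k : psum beta k.+1 = psum beta k + beta k.
Proof. by rewrite /psum big_nat_recr. Qed.

Lemma ang_le_sum_turn a p q : (forall k, a k != 0) -> (p <= q)%N ->
  ang (a p) (a q) <= \sum_(p <= k < q) turn a k.
Proof.
move=> a0; elim: q => [|q IH]; first by rewrite leqn0 => /eqP ->; rewrite angaa// big_geq.
rewrite leq_eqVlt => /predU1P[->|]; first by rewrite angaa// big_geq.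
rewrite ltnS => pq; rewrite big_nat_recr//=.
by rewrite (le_trans (ang_triangle (a0 _) (a0 q) (a0 _)))// lerD2r IH.
Qed.

Section Unfolding.
Variables (a : nat -> point3 R) (beta : nat -> R).
Hypotheses (a_cyc : cyclic a) (a_neq0 : forall k, a k != 0).
Hypotheses (b_cyc : cyclic beta) (turn_le : forall k, turn a k <= beta k).
Hypothesis (b_sum : \sum_(0 <= k < n) beta k = pi *+ 2).

Lemma psum_cyclic k : psum beta (k + n) = psum beta k + pi *+ 2.
Proof.
by apply/eqP; rewrite addrC -subr_eq psumB ?leq_addr// sum_cyclic ?b_sum.
Qed.

Lemma ang_le_psum p q : (p <= q)%N ->
  ang (a p) (a q) <= psum beta q - psum beta p.
Proof.
by move=> pq; rewrite psumB// (le_trans (ang_le_sum_turn _ _))// ler_sum.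
Qed.

(** Both arcs between the two vertices bound the angle, by [x] on one side and by [2 pi - x] on the
    other. These have the same cosine, and the smaller one lies in [[0, pi]], where [cos]
    decreases. *)
Lemma cos_psum_le p q :
  cos (psum beta q - psum beta p) <= cos (ang (a p) (a q)).
Proof.
wlog pq : p q / (p <= q)%N => [H|].
  have [|/ltnW] := leqP p q; first exact: H.
  by move=> /H; rewrite angC -cosN opprB.
rewrite -(subnKC pq); move: (q - p)%N => d {q pq}.
(* Whole revolutions change neither side, so the gap may be taken below [n]. *)
have -> : (p + d = p + d %% n + (d %/ n) * n)%N.
  by rewrite {1}(divn_eq d n) addnAC addnA.
have -> m k : psum beta (k + m * n)%N = psum beta k + pi *+ 2 *+ m.
  elim: m k => [|m IH] k; first by rewrite mul0n addn0 mulr0n addr0.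
  by rewrite mulSn addnA IH psum_cyclic [_ *+ m.+1]mulrS [RHS]addrA.
rewrite addrAC periodicn; last exact: cosD2pi.
rewrite cyclicM//.
have := ltn_pmod d n_gt0; move: (d %% n)%N => {}d dn.
have := ang_le_psum (leq_addr d p); set x := _ - _ => le1.
have le2 : ang (a p) (a (p + d)%N) <= pi *+ 2 - x.
  have : (p + d <= p + n)%N by lia.
  by move=> /ang_le_psum; rewrite psum_cyclic a_cyc angC /x; lra.
have [xpi|/ltW xpi] := leP x pi; first exact: le_cos (ang_ge0 _ _) le1 xpi.
rewrite -[x]opprK cosN -(@cosD2pi R (- x)) addrC.
by apply: le_cos (ang_ge0 _ _) le2 _; lra.
Qed.

(** Polar coordinates in a fixed plane: radius [nrm (a k)], angle the partial sum of [beta]. The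
    total [2 pi] is what closes the chain; the Gram matrix is all that distances need. *)
Lemma exists_development : exists2 B, cyclic B &
  forall p q, dot (B p) (B q) =
    nrm (a p) * nrm (a q) * cos (psum beta q - psum beta p).
Proof.
(* Orthogonality to 0 is vacuous: this call only supplies a unit vector. *)
have [e ee _] := exists_dot0 (0 : point3 R).
have [e' ee' e0] := exists_dot0 e.
exists (fun k => nrm (a k) *: (cos (psum beta k) *: e + sin (psum beta k) *: e')).
  move=> k; rewrite /= psum_cyclic a_cyc; congr (_ *: (_ *: _ + _ *: _)).
    exact: cosD2pi.
  exact: sinD2pi.
move=> p q; rewrite cosB !dotE (dotC e' e) ee ee' e0; ring.
Qed.

End Unfolding.

(** This is all that the geometric part retains of maximality; neither [f] nor the curve appears in
    it. *)
Definition tight (A : nat -> point3 R) := forall B, cyclic B ->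
  (forall k, dist (B k) (B k.+1) <= 1) ->
  (forall p q, dist (A p) (A q) <= dist (B p) (B q)) ->
  forall p q, dist (B p) (B q) = dist (A p) (A q).

Lemma dist_dot (a b : point3 R) : dist a b ^+ 2 = dot a a + dot b b - 2 * dot a b.
Proof. by rewrite distE nrm_sqr !dotE (dotC b a); ring. Qed.

Lemma dist_sub (a b c : point3 R) : dist (a - c) (b - c) = dist a b.
Proof. by rewrite !distE opprB addrA subrK. Qed.

Lemma ler_dist_sqr (a b c d : point3 R) :
  (dist a b <= dist c d) = (dist a b ^+ 2 <= dist c d ^+ 2).
Proof. by rewrite ler_pXn2r ?nnegrE ?dist_ge0. Qed.

Variable A : nat -> point3 R.
Hypotheses (A_cyc : cyclic A) (A_edge : forall k, dist (A k) (A k.+1) <= 1).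
Hypothesis (A_tight : tight A).

(* The angles [beta] may exceed those of [A] seen from [O], provided the
   longer edges of the development still have length at most 1. *)
Lemma tight_cos_psum (O : point3 R) beta (a := fun k => A k - O) :
  (forall k, a k != 0) -> cyclic beta -> (forall k, turn a k <= beta k) ->
  \sum_(0 <= k < n) beta k = pi *+ 2 ->
  (forall k, nrm (a k) ^+ 2 + nrm (a k.+1) ^+ 2 -
     2 * (nrm (a k) * nrm (a k.+1) * cos (beta k)) <= 1) ->
  forall p q, cos (psum beta q - psum beta p) = cos (ang (a p) (a q)).
Proof.
move=> a0 b_cyc ab bs be p q.
have a_cyc : cyclic a by move=> k; rewrite /a A_cyc.
have [B cB BE] := exists_development a_cyc b_cyc bs.
(* Law of cosines in the development and in the polygon: the radii agree, so comparing distances is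
   comparing cosines. *)
have distB i j : dist (B i) (B j) ^+ 2 = nrm (a i) ^+ 2 + nrm (a j) ^+ 2 -
     2 * (nrm (a i) * nrm (a j) * cos (psum beta j - psum beta i)).
  by rewrite dist_dot !BE !subrr cos0 !mulr1 !expr2.
have distA i j : dist (A i) (A j) ^+ 2 = nrm (a i) ^+ 2 + nrm (a j) ^+ 2 -
     2 * (nrm (a i) * nrm (a j) * cos (ang (a i) (a j))).
  by rewrite -(dist_sub _ _ O) dist_dot -dot_ang -!nrm_sqr.
have nn i j : 0 < nrm (a i) * nrm (a j) by rewrite mulr_gt0 ?nrm_gt0.
have : dist (B p) (B q) = dist (A p) (A q).
  apply: A_tight => // [k|i j].
    rewrite -(@ler_pXn2r _ 2) ?nnegrE ?dist_ge0// distB expr1n.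
    have -> : psum beta k.+1 - psum beta k = beta k by rewrite psumS; ring.
    exact: be.
  rewrite ler_dist_sqr distA distB lerD2l lerN2 ler_pM2l// ler_pM2l//.
  exact: cos_psum_le.
move=> /(congr1 (fun x => x ^+ 2)); rewrite distA distB => /addrI /oppr_inj.
by move=> /(mulfI _) H; apply: (mulfI (lt0r_neq0 (nn p q))); apply: H; rewrite pnatr_eq0.
Qed.

(** Here [beta] is the turn itself, so the development keeps every edge length and tightness makes
    it congruent to [A]. *)
Lemma tight_gram (O : point3 R) (a := fun k => A k - O) :
  (forall k, a k != 0) -> total_turn a = pi *+ 2 ->
  forall p q, dot (a p) (a q) =
    nrm (a p) * nrm (a q) * cos (psum (turn a) q - psum (turn a) p).
Proof.
move=> a0 at2 p q; rewrite dot_ang; congr (_ * _); apply/esym.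
apply: tight_cos_psum => // [|k].
  by apply: turn_cyclic => k; rewrite /a A_cyc.
rewrite -/(a _) -/(a _) -/a -dot_ang !nrm_sqr -dist_dot dist_sub.
by rewrite -[leRHS](expr1n _ 2) ler_pXn2r ?nnegrE ?dist_ge0.
Qed.

End Development.

(** * Planar Gram matrices and winding directions *)

Section Winding.
Context {R : realType}.
Implicit Types (a d : nat -> point3 R) (phi : nat -> R).

(** A Gram matrix determines vectors up to isometry. After normalisation [u] is the direction of
    [a j], and [v] comes by Gram-Schmidt from a direction not parallel to it; the formula for [a k]
    holds because the difference of its two sides has norm 0. *)
Lemma gram_embedding a phi j : (forall k, a k != 0) ->
  (forall p q, dot (a p) (a q) = nrm (a p) * nrm (a q) * cos (phi q - phi p)) ->
  exists u v, orthonormal2 u v /\ forall k,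
    a k = nrm (a k) *: (cos (phi k - phi j) *: u + sin (phi k - phi j) *: v).
Proof.
move=> a0 gram; pose e k := (nrm (a k))^-1 *: a k.
have n0 k : nrm (a k) != 0 by rewrite nrm_eq0.
have aE k : a k = nrm (a k) *: e k by rewrite scalerA mulfV// scale1r.
have ee p q : dot (e p) (e q) = cos (phi q - phi p).
  by rewrite /e dotZl dotZr gram; field; rewrite !n0.
clearbody e; have ej : dot (e j) (e j) = 1 by rewrite ee subrr cos0.
have ekj k : dot (e k) (e j) = cos (phi k - phi j) by rewrite dotC ee.
suff [v [ejv vv H]] : exists v, [/\ dot (e j) v = 0, dot v v = 1 &
    forall k, e k = cos (phi k - phi j) *: e j + sin (phi k - phi j) *: v].
  by exists (e j), v; split => // k; rewrite {1}aE H.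
(* If all directions are parallel to [e j], the sines vanish and any unit vector orthogonal to [e j]
   serves as [v]. *)
have [[m sm]|ns] := pselect (exists m, sin (phi m - phi j) != 0); last first.
  have [v vv ejv] := exists_dot0 (e j); exists v; split => // k.
  have s0 : sin (phi k - phi j) = 0.
    by apply/eqP; apply: contra_notT ns => ?; exists k.
  rewrite s0 scale0r addr0; apply/eqP; rewrite -subr_eq0 -dot_eq0; apply/eqP.
  rewrite !dotE ej (dotC (e j) (e k)) !ekj ee subrr cos0.
  by rewrite -[RHS](expr0n R 2) -s0 sin2cos2; ring.
set c := cos (phi m - phi j); set s := sin (phi m - phi j).
have c2 : c ^+ 2 = 1 - s ^+ 2 by rewrite cos2sin2.
exists (s^-1 *: (e m - c *: e j)); split => [||k].
- by rewrite !dotE ej (dotC _ (e m)) ekj -/c mulr1 subrr mulr0.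
- rewrite !dotE ej (dotC (e j) (e m)) ekj ee subrr cos0 -/c.
  transitivity (s^-1 * (s^-1 * (1 - c ^+ 2))); first by ring.
  by rewrite c2; field.
apply/eqP; rewrite -subr_eq0 -dot_eq0; apply/eqP.
have ekm : dot (e k) (e m) = cos (phi k - phi j) * c + sin (phi k - phi j) * s.
  by rewrite dotC ee -cosB; congr cos; ring.
have ck : cos (phi k - phi j) ^+ 2 = 1 - sin (phi k - phi j) ^+ 2.
  by rewrite cos2sin2.
rewrite !dotE (dotC (e m) (e k)) (dotC (e j) (e k)) (dotC (e j) (e m)) !ekj ekm.
rewrite -/c (ee k k) (ee m m) !subrr !cos0.
move: ck c2; set x := cos _; set y := sin _ => ck c2.
transitivity (1 - x ^+ 2 - y ^+ 2 + (y / s) ^+ 2 * (1 - c ^+ 2 - s ^+ 2)).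
  by field.
by rewrite ck c2; ring.
Qed.

Lemma nat_crossing (P : pred nat) n : P 0%N -> ~~ P n ->
  exists q, [/\ (q < n)%N, P q & ~~ P q.+1].
Proof.
move=> P0; elim: n => [|n IH]; first by rewrite P0.
by have [Pn nPn|/IH[q [qn ? ?]]] := boolP (P n); [exists n|exists q; split=> //; lia].
Qed.

(** The revolution contains a step from some [s <= pi] to some [t > pi], of length at most [pi];
    these two directions and the first one cannot share an open half-space. *)
Lemma winding_no_halfspace phi n (u v w : point3 R) :
  phi 0%N = 0 -> phi n = pi *+ 2 ->
  (forall k, phi k <= phi k.+1 <= phi k + pi) ->
  ~ forall k, 0 < dot (cos (phi k) *: u + sin (phi k) *: v) w.
Proof.
move=> phi0 phin phiS pos; have pi0 := @pi_gt0 R.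
have [||q [_ /= sle]] := @nat_crossing (fun k => phi k <= pi) n.
- by rewrite phi0; lra.
- by rewrite phin -ltNge; lra.
rewrite -ltNge => tgt.
have phi_ge0 k : 0 <= phi k.
  by elim: k => [|k IH]; [rewrite phi0|have := phiS k; lra].
have sn : phi q.+1 <= pi *+ 2.
  have mono i j : (i <= j)%N -> phi i <= phi j.
    move=> ij; rewrite -(subnKC ij); elim: (j - i)%N => [|m IH]; rewrite ?addn0//.
    by rewrite addnS (le_trans IH)//; have /andP[] := phiS (i + m)%N.
  rewrite -phin; apply: (mono); rewrite ltnNge; apply/negP => /mono.
  by rewrite phin; lra.
have := pos 0%N; have := pos q; have := pos q.+1; have := phiS q.
have := phi_ge0 q; move: sle tgt sn; set s := phi q; set t := phi q.+1.
rewrite phi0 cos0 sin0 scale1r scale0r addr0 !dotE.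
set X := dot u w; set Y := dot v w => sle tgt tle s0 /andP[st ts] Lt Ls X0.
(* The directions at angles 0, [s], [t] have 0 in their convex hull. *)
have id : sin (t - s) * X + sin s * (cos t * X + sin t * Y) =
    sin t * (cos s * X + sin s * Y) by rewrite sinB; ring.
have h1 : 0 <= sin (t - s) by apply: sin_ge0_pi; lra.
have h2 : 0 <= sin s by apply: sin_ge0_pi; lra.
have h3 : sin t <= 0.
  rewrite -[t](subrK pi) sinDpi oppr_le0; apply: sin_ge0_pi; lra.
(* In [id] the left side is nonnegative and the right side nonpositive, so [sin s = 0]. Positivity
   at [s] then gives [s = 0], and a step of at most [pi] from there cannot exceed [pi]. *)
have ss : sin s = 0.
  apply/eqP; rewrite eq_le h2 andbT leNgt; apply/negP => ss.
  have : 0 < sin s * (cos t * X + sin t * Y) by rewrite mulr_gt0.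
  have : 0 <= sin (t - s) * X by rewrite mulr_ge0// ltW.
  have : sin t * (cos s * X + sin s * Y) <= 0 by rewrite mulr_le0_ge0// ltW.
  lra.
have cs : 0 < cos s by move: Ls; rewrite ss mul0r addr0 pmulr_lgt0.
have s_eq0 : s = 0.
  apply: cos_inj; rewrite ?in_itv/= ?s0 ?sle ?lexx ?(ltW pi0)// cos0.
  by have := sin0cos1 ss; rewrite gtr0_norm.
lra.
Qed.

Lemma turnZ a k : 0 < k -> turn (fun i => k *: a i) = turn a.
Proof. by move=> k0; apply/funext => i; rewrite /turn angZ. Qed.

Lemma continuous_sum_turn a d m (t : R) : (forall k, a k + t *: d k != 0) ->
  {for t, continuous
    (fun s : R => \sum_(0 <= k < m) turn (fun i => a i + s *: d i) k)}.
Proof.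
move=> nz; elim: m => [|m IH].
  rewrite (_ : (fun _ => _) = cst 0); first exact: cst_continuous.
  by apply/funext => s; rewrite big_geq.
rewrite (_ : (fun _ => _) = (fun s : R =>
    \sum_(0 <= k < m) turn (fun i => a i + s *: d i) k +
    turn (fun i => a i + s *: d i) m)); last first.
  by apply/funext => s; rewrite big_nat_recr.
by apply: continuousD => //; exact: continuous_ang.
Qed.

(** The infinite ray is compactified by [s = t / (1 - t)]: angles ignore the factor [1 - t], and at
    [t = 1] every vector becomes [- w], with total turn 0. The intermediate value theorem then
    applies on [[0, 1]]. *)
Lemma exists_total_turn_2pi n a (w : point3 R) : w != 0 ->
  (forall s k, 0 <= s -> a k - s *: w != 0) ->
  pi *+ 2 <= total_turn n a ->
  exists2 s, 0 <= s & total_turn n (fun k => a k - s *: w) = pi *+ 2.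
Proof.
move=> w0 nz ge.
pose h (t : R) := total_turn n (fun k => a k + t *: - (a k + w)).
have hE t : 0 <= t < 1 -> h t = total_turn n (fun k => a k - (t / (1 - t)) *: w).
  move=> /andP[t0 t1]; rewrite /h /total_turn.
  rewrite -(@turnZ (fun k => a k - (t / (1 - t)) *: w) (1 - t)) ?subr_gt0//.
  apply: eq_bigr => k _; congr (turn _ k); apply/funext => i.
  rewrite scalerBr scalerA mulrC divfK ?subr_eq0 ?gt_eqF// scalerN scalerDr.
  by rewrite scalerBl scale1r opprD addrA.
have h1 : h 1 = 0.
  rewrite /h /total_turn big1// => k _; rewrite /turn !scale1r !opprD.
  by rewrite !addrA !subrr !add0r angaa// oppr_eq0.
have nzt t k : 0 <= t <= 1 -> a k + t *: - (a k + w) != 0.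
  move=> /andP[t0]; rewrite le_eqVlt => /predU1P[->|t1].
    by rewrite scale1r opprD addrA subrr add0r oppr_eq0.
  have := nz (t / (1 - t)) k; rewrite divr_ge0 ?subr_ge0 ?(ltW t1)// => /(_ isT).
  apply: contra_neq => e; apply: (@scalerI _ _ (1 - t)); first by rewrite subr_eq0 gt_eqF.
  rewrite scaler0 scalerBr scalerA mulrC divfK ?subr_eq0 ?gt_eqF//.
  by rewrite -e scalerN scalerDr scalerBl scale1r opprD addrA.
have pi0 := @pi_gt0 R.
have [] := @IVT R h 0 1 (pi *+ 2) ler01.
- apply: continuous_in_subspaceT => t; rewrite inE/= in_itv/= => t01.
  by apply: continuous_sum_turn => k; exact: nzt.
- have -> : h 0 = total_turn n a.
    rewrite hE ?lexx ?ltr01// mul0r.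
    by congr total_turn; apply/funext => k; rewrite scale0r subr0.
  by rewrite h1 ge_min le_max; apply/andP; split; apply/orP; [right|left] => //; lra.
move=> t; rewrite in_itv/= => /andP[t0 t1 ht].
have t1' : t < 1.
  rewrite lt_neqAle t1 andbT; apply/eqP => t1E; move: ht; rewrite t1E h1; lra.
by exists (t / (1 - t)); [rewrite divr_ge0 ?subr_ge0//|rewrite -hE ?t0].
Qed.

End Winding.

(** * A tight polygon is planar, with total angle [2 pi] at its edge points *)

Section Tight.
Context {R : realType}.
Variables (n : nat) (A : nat -> point3 R).
Hypotheses (n_gt0 : (0 < n)%N) (A_cyc : cyclic n A).
Hypotheses (A_edge : forall k, dist (A k) (A k.+1) <= 1) (A_tight : tight n A).
Implicit Types (O N u v w : point3 R).

Definition seen O k : point3 R := A k - O.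
Definition off_vertices O := forall k, seen O k != 0.
Definition theta O := total_turn n (seen O).

Lemma seen_cyclic O : cyclic n (seen O).
Proof. by move=> k; rewrite /seen A_cyc. Qed.

Lemma off_verticesP O : (forall k, (k < n)%N -> A k != O) -> off_vertices O.
Proof.
move=> H k; rewrite /seen subr_eq0 -(cyclic_mod k A_cyc).
by apply: H; rewrite ltn_mod.
Qed.

Lemma theta_embedding O j : off_vertices O -> theta O = pi *+ 2 ->
  let phi k := \sum_(j <= i < j + k) turn (seen O) i in
  exists u v, orthonormal2 u v /\ forall k, seen O (j + k)%N =
    nrm (seen O (j + k)%N) *: (cos (phi k) *: u + sin (phi k) *: v).
Proof.
move=> nz t2 phi.
have G := tight_gram n_gt0 A_cyc A_edge A_tight nz t2.
have [u [v [uv E]]] := gram_embedding j nz G.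
exists u, v; split => // k.
by rewrite {1}E psumB ?leq_addr.
Qed.

Lemma theta_no_halfspace O w : off_vertices O -> theta O = pi *+ 2 ->
  ~ forall k, 0 < dot (seen O k) w.
Proof.
move=> nz t2 pos; have [u [v [uv E]]] := theta_embedding 0 nz t2.
apply: (@winding_no_halfspace _ (fun k => \sum_(0 <= i < 0 + k) turn (seen O) i)
  n u v w) => /= [|//|k|k].
- by rewrite big_geq.
- by rewrite big_nat_recr//= lerDl ang_ge0 lerD2l ang_lepi.
- have := pos k; rewrite -{1}(add0n k) E dotZl pmulr_rgt0// nrm_gt0.
  exact: nz.
Qed.

Lemma ray_theta O w : w != 0 -> (forall s, 0 <= s -> off_vertices (O + s *: w)) ->
  pi *+ 2 <= theta O -> exists2 s, 0 <= s & theta (O + s *: w) = pi *+ 2.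
Proof.
move=> w0 nz t2.
have seenD s k : seen (O + s *: w) k = seen O k - s *: w by rewrite /seen opprD addrA.
have [|s s0 sE] := exists_total_turn_2pi w0 _ t2.
  by move=> s k /nz /(_ k); rewrite seenD.
exists s => //; rewrite -sE; congr total_turn.
by apply/funext => k; rewrite seenD.
Qed.

Lemma seen_edge i (t : R) (O := A i + t *: (A i.+1 - A i)) :
  (seen O i = - (t *: (A i.+1 - A i))) *
  (seen O i.+1 = (1 - t) *: (A i.+1 - A i)).
Proof.
rewrite /seen /O; split; first by rewrite opprD addrA subrr add0r.
by rewrite opprD addrA scalerBl scale1r.
Qed.

Lemma turn_edge i (t : R) : A i != A i.+1 -> 0 < t < 1 ->
  turn (seen (A i + t *: (A i.+1 - A i))) i = pi.
Proof.
move=> Ai /andP[t0 t1]; have d0 : A i.+1 - A i != 0 by rewrite subr_eq0 eq_sym.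
rewrite /turn !seen_edge angC.
have -> : t *: (A i.+1 - A i) = (t / (1 - t)) *: ((1 - t) *: (A i.+1 - A i)).
  by rewrite scalerA divfK// subr_eq0 gt_eqF.
rewrite ang_opp// ?divr_gt0 ?subr_gt0// scaler_eq0 negb_or d0 andbT.
by rewrite subr_eq0 gt_eqF.
Qed.

(** Edge [i] is seen under [pi]; the remaining turns lead from [A i.+1] round to [A i], which lie in
    opposite directions, and so add at least another [pi]. *)
Lemma theta_edge_ge i (t : R) (O := A i + t *: (A i.+1 - A i)) :
  A i != A i.+1 -> 0 < t < 1 -> off_vertices O -> pi *+ 2 <= theta O.
Proof.
move=> Ai t01 nz; have te := turn_edge Ai t01.
rewrite /theta /total_turn -(sum_cyclic n_gt0 i (turn_cyclic (seen_cyclic O))).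
rewrite big_ltn ?te; last by lia.
rewrite -{1}te mulr2n -te lerD2l.
apply: le_trans (ang_le_sum_turn nz _); last by lia.
by rewrite seen_cyclic angC lexx.
Qed.

(** Each vertex excludes at most one parameter; the interval is cut to the left of it, one vertex at
    a time. *)
Lemma exists_off_vertices P Q (x y : R) : P != Q -> x < y ->
  exists2 t, x < t < y & off_vertices (P + t *: (Q - P)).
Proof.
move=> PQ xy.
suff [x' [y' [x'y' xx' y'y H]]] : exists x' y', [/\ x' < y', x <= x', y' <= y &
    forall t, x' < t < y' -> forall k, (k < n)%N -> A k != P + t *: (Q - P)].
  exists ((x' + y') / 2); first by lra.
  by apply: off_verticesP; apply: H; lra.
elim: n => [|m [x' [y' [x'y' xx' y'y H]]]]; first by exists x, y; split => //; lra.
have [[t0 t0I Am]|none] :=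
    pselect (exists2 t0, x' < t0 < y' & A m = P + t0 *: (Q - P)); last first.
  exists x', y'; split => // t tI k; rewrite ltnS leq_eqVlt => /predU1P[->|/H]; last exact.
  by apply/eqP => Am; apply: none; exists t.
exists x', t0; split => // [||t tI k]; [lra|lra|].
rewrite ltnS leq_eqVlt => /predU1P[->|/H]; last by apply; lra.
rewrite Am (inj_eq (addrI _)) -subr_eq0 -scalerBl scaler_eq0 !subr_eq0 negb_or.
by rewrite (eq_sym Q) PQ andbT; apply/eqP; lra.
Qed.

Lemma exists_generic_ray O : off_vertices O ->
  exists2 w, w != 0 & forall s, 0 <= s -> off_vertices (O + s *: w).
Proof.
(* [T] exceeds all slopes [y / x] of the seen vertices, whereas a vertex met by the ray would have
   slope exactly [T]. *)
move=> nz; pose T := 1 + \sum_(k < n) `|seen O k 0 1 / seen O k 0 0|.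
exists (vec3 1 T 0) => [|s s0].
  by apply/eqP => /rowP /(_ 0); rewrite vec3E mxE => /eqP; rewrite oner_eq0.
apply: off_verticesP => k kn; apply/eqP => Ak.
have sk : seen O k = s *: vec3 1 T 0 by rewrite /seen Ak addrC addKr.
have ks0 : s != 0.
  by apply: contra_neq (nz k) => s0'; rewrite sk s0' scale0r.
have kT : seen O k 0 1 / seen O k 0 0 = T.
  by rewrite sk !mxE /= mulr1 mulrC mulrA mulVf// mul1r.
have : `|seen O k 0 1 / seen O k 0 0| <= T - 1.
  rewrite /T addrC addKr (bigD1 (Ordinal kn))//= lerDl.
  by apply: sumr_ge0.
by rewrite kT => /(le_trans (ler_norm _)); lra.
Qed.

(** At a point of the ray where [theta] is [2 pi] all seen vectors lie in one plane; that point
    cancels in differences of vertices. *)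
Lemma tight_planar i : A i != A i.+1 ->
  exists2 N, dot N N = 1 & forall p q, dot (A p - A q) N = 0.
Proof.
move=> Ai; have [t t01 nz] := exists_off_vertices Ai ltr01.
have [w w0 wnz] := exists_generic_ray nz.
have [s s0 ts] := ray_theta w0 wnz (theta_edge_ge Ai t01 nz).
have [u [v [uv E]]] := theta_embedding 0 (wnz _ s0) ts.
have [N [NN uN vN]] := exists_normal uv; exists N => // p q.
have H k : dot (seen (A i + t *: (A i.+1 - A i) + s *: w) k) N = 0.
  by rewrite -(add0n k) E !dotE uN vN; ring.
rewrite (_ : A p - A q = seen (A i + t *: (A i.+1 - A i) + s *: w) p -
  seen (A i + t *: (A i.+1 - A i) + s *: w) q); first by rewrite dotDl dotNl !H subrr.
by rewrite /seen opprB [RHS]addrA subrK.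
Qed.

Section Normal.
Variables (N : point3 R) (NN : dot N N = 1).

Definition in_plane O := forall k, dot (seen O k) N = 0.

Lemma normal_neq0 : N != 0.
Proof. by rewrite -dot_eq0 NN oner_eq0. Qed.

(** From any point above the plane the vertices fill only the open half-space below, so [theta] is
    never [2 pi] there; a larger value would yield [2 pi] farther up the same ray. *)
Lemma off_plane O s : in_plane O -> 0 < s ->
  off_vertices (O + s *: N) /\ theta (O + s *: N) < pi *+ 2.
Proof.
move=> ON.
have D r k : dot (seen (O + r *: N) k) (- N) = r.
  rewrite /seen opprD addrA dotNr dotDl ON add0r dotNl dotZl NN; ring.
have nz r : 0 < r -> off_vertices (O + r *: N).
  by move=> r0 k; apply: contraTneq r0 => e; rewrite -(D r k) e dot0l ltxx.
move=> s0; split; first exact: nz.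
rewrite ltNge; apply/negP => /(ray_theta normal_neq0)[r r0|r r0].
  by rewrite -addrA -scalerDl; apply: nz; lra.
rewrite -addrA -scalerDl => /(theta_no_halfspace (w := - N)); apply.
  by apply: nz; lra.
by move=> k; rewrite D; lra.
Qed.

Lemma theta_in_plane O : in_plane O -> off_vertices O -> pi *+ 2 <= theta O ->
  theta O = pi *+ 2.
Proof.
move=> ON nz /(ray_theta normal_neq0)[s|s].
  rewrite le_eqVlt => /predU1P[<-|s0]; first by rewrite scale0r addr0.
  by have [] := off_plane ON s0.
rewrite le_eqVlt => /predU1P[<-|/(off_plane ON)[_ + e]].
  by rewrite scale0r addr0.
by rewrite e ltxx.
Qed.

End Normal.

End Tight.

(** * All edges have length 1 *)

Section UnitEdges.
Context {R : realType}.
Variables (n : nat) (A : nat -> point3 R).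
Hypotheses (n_gt1 : (1 < n)%N) (A_cyc : cyclic n A).
Hypotheses (A_edge : forall k, dist (A k) (A k.+1) <= 1) (A_tight : tight n A).

Let n_gt0 : (0 < n)%N := ltnW n_gt1.

Let edge_cyc : cyclic n (fun k => dist (A k) (A k.+1)).
Proof. by move=> k; rewrite -addSn !A_cyc. Qed.

Lemma dist_scale (k : R) (a b : point3 R) :
  dist (k *: a) (k *: b) = `|k| * dist a b.
Proof. by rewrite !distE -scalerBr nrmZ. Qed.

Lemma tight_not_constant : ~ forall p q, A p = A q.
Proof.
move=> Aconst; pose e : point3 R := vec3 1 0 0.
have ne : nrm e = 1 by rewrite /nrm dot3E !vec3E !mulr0 !addr0 mulr1 sqrtr1.
(* If all vertices coincide, moving one of them to distance 1 is a strict gain; [n > 1] leaves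
   another vertex behind. *)
pose B k : point3 R := if (k %% n == 0)%N then e else 0.
have /(_ 0%N 1%N) : forall p q, dist (B p) (B q) = dist (A p) (A q).
  apply: A_tight => [k|k|p q].
  - by rewrite /B modnDr.
  - rewrite /B; case: ifP => _; case: ifP => _; rewrite distE ?subrr ?subr0 ?sub0r ?nrmN ?ne//;
    by rewrite /nrm dot0l sqrtr0.
  - by rewrite (Aconst p q) distE subrr {1}/nrm dot0l sqrtr0 dist_ge0.
rewrite (Aconst 0%N 1%N) /B mod0n modn_small// !distE subrr subr0 ne.
by rewrite /nrm dot0l sqrtr0 => /eqP; rewrite oner_eq0.
Qed.

(** Otherwise scaling by the inverse of the longest edge would lengthen that edge, shrink no
    distance and keep all edges at most 1. *)
Lemma tight_exists_unit_edge : exists j, dist (A j) (A j.+1) = 1.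
Proof.
have [j _ jmax] := arg_maxP (fun k : 'I_n => dist (A k) (A k.+1))
  (isT : predT (Ordinal n_gt0)).
have {}jmax k : dist (A k) (A k.+1) <= dist (A j) (A j.+1).
  rewrite -(cyclic_mod k edge_cyc).
  by apply: (jmax (Ordinal (ltn_pmod k n_gt0))).
exists j; apply/eqP; rewrite eq_le A_edge /= leNgt; apply/negP => lt1.
set m := dist (A j) _ in jmax lt1.
have m0 : 0 < m.
  rewrite lt_def dist_ge0 andbT; apply/eqP => m0; apply: tight_not_constant.
  have A0 k : A k = A 0%N.
    elim: k => // k <-; apply/eqP; rewrite eq_sym -dist_eq0 eq_le dist_ge0 andbT.
    by rewrite -m0 jmax.
  by move=> p q; rewrite A0 [RHS]A0.
pose B k := m^-1 *: A k.
have BE p q : dist (B p) (B q) = m^-1 * dist (A p) (A q).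
  by rewrite dist_scale gtr0_norm ?invr_gt0.
have : dist (B j) (B j.+1) = m.
  apply: A_tight => [k|k|p q]; first by rewrite /B A_cyc.
  - by rewrite BE mulrC ler_pdivrMr// mul1r jmax.
  - by rewrite BE ler_peMl ?dist_ge0// invf_ge1// ltW.
by rewrite BE -/m mulVf ?gt_eqF// => m1; move: lt1; rewrite -m1 ltxx.
Qed.

Lemma dist_turn_pi O i : turn (seen A O) i = pi ->
  dist (A i) (A i.+1) = dist O (A i) + dist O (A i.+1).
Proof.
move=> ti; apply/eqP; rewrite -(@eqrXn2 _ 2) ?addr_ge0 ?dist_ge0//; apply/eqP.
rewrite -(dist_sub _ _ O) dist_dot (dot_ang (A i - O) (A i.+1 - O)).
rewrite [ang _ _]ti cospi -!nrm_sqr.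
by rewrite !(distC O) !distE /seen; ring.
Qed.

(** Two points near opposite ends of the unit edge [j] are farther apart than edge [i] is long. A
    point seeing edge [i] under [pi] lies on it, so they cannot both do so. *)
Lemma exists_edge_point i j : dist (A i) (A i.+1) < 1 ->
  dist (A j) (A j.+1) = 1 ->
  exists t, [/\ 0 < t < 1, off_vertices A (A j + t *: (A j.+1 - A j)) &
    turn (seen A (A j + t *: (A j.+1 - A j))) i < pi].
Proof.
move=> di dj; set O := fun t => A j + t *: (A j.+1 - A j).
have Aj : A j != A j.+1 by rewrite -dist_eq0 dj oner_eq0.
pose h := (1 - dist (A i) (A i.+1)) / 2.
have h0 : 0 < h by rewrite /h; lra.
have hd : 1 - h * 2 = dist (A i) (A i.+1) by rewrite /h; lra.
have [t tI nt] := exists_off_vertices n_gt0 A_cyc Aj h0.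
have [t' t'I nt'] : exists2 t', 1 - h < t' < 1 & off_vertices A (O t').
  by apply: (exists_off_vertices n_gt0 A_cyc Aj); lra.
have := dist_ge0 (A i) (A i.+1) => di0.
have [lt|] := ltP (turn (seen A (O t)) i) pi.
  by exists t; split => //; lra.
rewrite le_eqVlt ltNge ang_lepi orbF => /eqP/esym/dist_turn_pi e.
have [lt|] := ltP (turn (seen A (O t')) i) pi.
  by exists t'; split => //; lra.
rewrite le_eqVlt ltNge ang_lepi orbF => /eqP/esym/dist_turn_pi e'.
have dO : dist (O t) (O t') = t' - t.
  rewrite distC distE /O opprD addrACA subrr add0r -scalerBl nrmZ -distE.
  by rewrite distC dj mulr1 ger0_norm//; lra.
have := dist_triangle (A i) (O t) (O t').
have := dist_triangle (A i.+1) (O t) (O t').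
rewrite dO (distC _ (O t')) (distC _ (O t')); lra.
Qed.

(** At a small height [s] above a point of a unit edge, [theta] falls short of [2 pi] by some
    [de s > 0]. Adding this deficit to the turn of the short edge [i] gives an admissible
    development in which that edge is strictly longer, against tightness. *)
Lemma tight_unit_edges k : dist (A k) (A k.+1) = 1.
Proof.
apply/eqP; rewrite eq_le A_edge /= leNgt; apply/negP.
rewrite -(cyclic_mod k edge_cyc); set i := (k %% n)%N => di.
have lein : (i < n)%N by rewrite ltn_mod.
have [j dj] := tight_exists_unit_edge.
have [t [t01 nz ti]] := exists_edge_point di dj.
have Aj : A j != A j.+1 by rewrite -dist_eq0 dj oner_eq0.
have [N NN AN] := tight_planar n_gt0 A_cyc A_edge A_tight Aj.
set O := A j + _ in nz ti.
have ON : in_plane A N O.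
  by move=> q; rewrite /seen opprD addrA dotDl AN dotNl dotZl AN; ring.
have tO := theta_in_plane n_gt0 A_cyc A_edge A_tight NN ON nz
  (theta_edge_ge n_gt0 A_cyc Aj t01 nz).
have seenN s q : seen A (O + s *: N) q = seen A O q + s *: (- N).
  by rewrite /seen opprD addrA scalerN.
pose al (s : R) := turn (seen A (O + s *: N)) i.
pose de (s : R) := pi *+ 2 - theta n A (O + s *: N).
have nz0 q : seen A O q + 0 *: (- N) != 0 by rewrite scale0r addr0; exact: nz.
have alC : {for 0, continuous al}.
  rewrite (_ : al = fun s : R => ang (seen A O i + s *: (- N)) (seen A O i.+1 + s *: (- N))).
    by apply: continuous_ang; exact: nz0.
  by apply/funext => s; rewrite /al /turn !seenN.
have deC : {for 0, continuous de}.
  rewrite (_ : de = fun s : R => pi *+ 2 -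
      \sum_(0 <= q < n) turn (fun r => seen A O r + s *: (- N)) q).
    apply: cvgB; first exact: cvg_cst.
    exact: (@continuous_sum_turn _ (seen A O) (fun=> - N) n 0 nz0).
  apply/funext => s; rewrite /de /theta /total_turn; congr (_ - _).
  by apply: eq_bigr => q _; rewrite /turn !seenN.
have O0 : O + 0 *: N = O by rewrite scale0r addr0.
have de0 : de 0 = 0 by rewrite /de O0 tO subrr.
have sumC : {for 0, continuous (fun s => al s + de s)} by exact: cvgD.
pose nr (q : nat) (s : R) := nrm (seen A O q + s *: (- N)).
have nrC q : {for 0, continuous (nr q)} by exact: continuous_nrm.
(* Squared length of edge [i] once its turn is opened by [de s]; as [s] tends to 0 it tends to the
   old squared length, which is below 1. *)
pose len (s : R) := nr i s ^+ 2 + nr i.+1 s ^+ 2 -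
  2 * (nr i s * nr i.+1 s * cos (al s + de s)).
have lenC : {for 0, continuous len}.
  apply: cvgB; first by apply: cvgD; rewrite /GRing.exp/=; apply: cvgM; exact: nrC.
  apply: cvgM; first exact: cvg_cst.
  apply: cvgM; first by apply: cvgM; exact: nrC.
  by apply: (@continuous_comp _ _ _ (fun s => al s + de s) cos) => //; exact: continuous_cos.
have len0 : len 0 < 1.
  rewrite /len /nr !scale0r !addr0 de0 addr0 /al /turn O0 -dot_ang !nrm_sqr.
  by rewrite -dist_dot dist_sub expr_lt1// dist_ge0.
have sum0 : al 0 + de 0 < pi by rewrite de0 addr0 /al O0.
have H1 : \forall s \near (0 : R), al s + de s < pi by exact: (sumC _ (lt_nbhsl sum0)).
have H2 : \forall s \near (0 : R), len s < 1 by exact: (lenC _ (lt_nbhsl len0)).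
have [s [s0 [lt1 lt2]]] : exists s, 0 < s /\ (al s + de s < pi /\ len s < 1).
  suff /filter_ex[s [s0 h]] :
      \forall s \near 0^'+, 0 < s /\ (al s + de s < pi /\ len s < 1) by exists s.
  near=> s; split; first by near: s; exact: nbhs_right_gt.
  by split; near: s; apply: cvg_within; [exact: H1|exact: H2].
have [nzs ths] := off_plane n_gt0 A_cyc A_edge A_tight NN ON s0.
pose beta q := turn (seen A (O + s *: N)) q + (if (q %% n == i)%N then de s else 0).
have des : 0 < de s by rewrite /de subr_gt0.
have beta_cyc : cyclic n beta.
  move=> q; rewrite /beta modnDr; congr (_ + _).
  exact: (turn_cyclic (seen_cyclic A_cyc _)).
have betai : beta i = al s + de s by rewrite /beta modn_small// eqxx.
have : cos (psum beta i.+1 - psum beta i) =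
    cos (ang (seen A (O + s *: N) i) (seen A (O + s *: N) i.+1)).
  apply: (tight_cos_psum n_gt0 A_cyc A_tight nzs) => [q|q||q].
  - exact: beta_cyc.
  - by rewrite lerDl; case: ifP => // _; exact: ltW.
  - rewrite /beta big_split/= -/(total_turn n _) -/(theta n A _).
    rewrite big_mkord (bigD1 (Ordinal lein))//= modn_small// eqxx.
    rewrite big1 ?addr0 => [|q /eqP qi]; first by rewrite /de; ring.
    rewrite modn_small//; case: eqP => // qi'; case: qi; exact/val_inj.
  - have [qi|qi] := eqVneq (q %% n)%N i.
      have := ltW lt2; rewrite /len /nr -!seenN -betai.
      have c1 : cyclic n (fun k => A k.+1) by move=> r; rewrite -addSn A_cyc.
      have := cyclic_mod q c1; rewrite /= qi => <-.
      by rewrite -(cyclic_mod q beta_cyc) -(cyclic_mod q A_cyc) qi.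
    rewrite /beta (negPf qi) addr0 -/(seen _ _ _) -/(seen _ _ _) -dot_ang !nrm_sqr.
    by rewrite -dist_dot dist_sub expr_le1// dist_ge0.
have -> : psum beta i.+1 - psum beta i = beta i by rewrite psumS; ring.
(* On [[0, pi]] equal cosines mean equal angles, but these two differ by [de s > 0]. *)
move=> /cos_inj; rewrite betai !in_itv/= !ang_ge0 ang_lepi.
rewrite addr_ge0 ?ang_ge0 ?(ltW lt1) ?(ltW des)// => /(_ isT isT).
rewrite /al -/(turn _ _); lra.
Unshelve. all: by end_near.
Qed.

End UnitEdges.

(** * Polygons seen from their edges *)

Section Fans.
Context {R : realType}.
Variables (n : nat) (A : nat -> point3 R).
Hypotheses (n_gt1 : (1 < n)%N) (A_cyc : cyclic n A).
Hypotheses (A_edge : forall k, dist (A k) (A k.+1) <= 1) (A_tight : tight n A).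
Variables (N : point3 R) (NN : dot N N = 1).
Hypothesis A_plane : forall p q, dot (A p - A q) N = 0.
Hypothesis A_noncol :
  ~ exists P v : point3 R, forall k, exists s, A k = P + s *: v.

Let n_gt0 : (0 < n)%N := ltnW n_gt1.

Definition dir k := A k.+1 - A k.
Definition edge_pt k (t : R) := A k + t *: dir k.

Lemma dir_unit k : dot (dir k) (dir k) = 1.
Proof.
rewrite -nrm_sqr -distE distC.
by rewrite (tight_unit_edges n_gt1 A_cyc A_edge A_tight) expr1n.
Qed.

Lemma dir_neq0 k : dir k != 0.
Proof. by rewrite -dot_eq0 dir_unit oner_eq0. Qed.

Lemma edge_neq k : A k != A k.+1.
Proof. by rewrite eq_sym -subr_eq0 dir_neq0. Qed.

Lemma dir_cyclic : cyclic n dir.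
Proof. by move=> k; rewrite /dir -addSn !A_cyc. Qed.

Lemma edge_pt_cyclic t : cyclic n (edge_pt^~ t).
Proof. by move=> k; rewrite /edge_pt dir_cyclic A_cyc. Qed.

Lemma dir_plane k : dot (dir k) N = 0.
Proof. exact: A_plane. Qed.

Lemma edge_pt_plane k t q : dot (seen A (edge_pt k t) q) N = 0.
Proof. by rewrite /seen opprD addrA dotDl A_plane dotNl dotZl dir_plane; ring. Qed.

Lemma frame_expand (u v P : point3 R) : orthonormal2 u v ->
  dot u N = 0 -> dot v N = 0 -> dot P N = 0 -> P = dot P u *: u + dot P v *: v.
Proof.
move=> [uu vv uv] uN vN PN; apply/eqP; rewrite -subr_eq0 -dot_eq0.
set Q := P - _.
have Qu : dot Q u = 0 by rewrite /Q !dotE (dotC v u) uu uv; ring.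
have Qv : dot Q v = 0 by rewrite /Q !dotE vv uv; ring.
have QN : dot Q N = 0 by rewrite /Q !dotE uN vN PN; ring.
(* The rows [u], [v], [N] form an orthogonal matrix, and [Q] is orthogonal to each of them. *)
pose M : 'M[R]_3 := \matrix_(i < 3, j < 3)
  (if i == 0 then u 0 j else if i == 1 then v 0 j else N 0 j).
have MM : M *m M^T = 1%:M.
  apply/matrixP => i j; rewrite !mxE.
  have E (a b : point3 R) : (forall k, M i k = a 0 k) ->
      (forall k, M j k = b 0 k) -> \sum_k M i k * M^T k j = dot a b.
    by move=> Ha Hb; apply: eq_bigr => k _; rewrite Ha mxE Hb.
  by case: i E => -[|[|[|//]]] i3; case: j => -[|[|[|//]]] j3 E;
     rewrite (E _ _ (fun k => mxE _ _ _ _) (fun k => mxE _ _ _ _)) /=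
       ?uu ?vv ?NN ?uv ?uN ?vN ?(dotC v u) ?(dotC N) ?uv ?uN ?vN.
have QM : Q *m M^T = 0.
  apply/rowP => j; rewrite !mxE.
  have E (b : point3 R) : (forall k, M j k = b 0 k) ->
      \sum_k Q 0 k * M^T k j = dot Q b.
    by move=> Hb; apply: eq_bigr => k _; rewrite [M^T k j]mxE Hb.
  by case: j E => -[|[|[|//]]] j3 E; rewrite (E _ (fun k => mxE _ _ _ _)) /=.
have -> : Q = 0 by rewrite -[Q]mulmx1 -(mulmx1C MM) mulmxA QM mul0mx.
by rewrite dot0l.
Qed.

(* In the frame [(dir i, v)] at [O], the vertices following edge [i] have
   nondecreasing polar angles in [0, pi]. *)
Definition fan i O v :=
  let x k := dot (seen A O (i.+1 + k)) (dir i) in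
  let y k := dot (seen A O (i.+1 + k)) v in
  [/\ orthonormal2 (dir i) v, dot v N = 0,
    forall p q, (p <= q < n)%N -> 0 <= x p * y q - y p * x q,
    forall k, (k < n)%N -> 0 <= y k &
    forall k, (k.+1 < n)%N -> x k * y k.+1 - y k * x k.+1 = 0 ->
      0 < x k * x k.+1 + y k * y k.+1].

Lemma line_noncol i O : ~ forall k, (k < n)%N ->
  exists s, A (i.+1 + k)%N = O + s *: dir i.
Proof.
move=> H; apply: A_noncol; exists O, (dir i) => k.
(* The term [n * i.+1] keeps the subtraction from truncating; the residue is the offset from [i.+1]
   to [k]. *)
have [s] := H ((k + n * i.+1 - i.+1) %% n)%N (ltn_pmod _ n_gt0).
rewrite -(cyclic_mod _ A_cyc) modnDmr (cyclic_mod _ A_cyc) => E.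
exists s; rewrite -E -(cyclicM i.+1 k A_cyc); congr A; nia.
Qed.

(** Edge [i] uses up one half turn of [2 pi], so the other vertices follow with polar angles rising
    from 0, in direction [dir i], to [pi]. A vertex off the line of the edge puts [v] in the plane
    and rules out a single jump from 0 to [pi]. *)
Lemma exists_fan i t (O := edge_pt i t) : 0 < t < 1 -> off_vertices A O ->
  exists v, fan i O v.
Proof.
move=> t01 nz; have pi0 := @pi_gt0 R.
have tO : theta n A O = pi *+ 2.
  apply: (theta_in_plane n_gt0 A_cyc A_edge A_tight NN) => //.
    by move=> q; exact: edge_pt_plane.
  exact: (theta_edge_ge n_gt0 A_cyc (edge_neq i)).
have [u [v [[uu vv uv] E]]] := theta_embedding n_gt0 A_cyc A_edge A_tight i.+1 nz tO.
pose phi k := \sum_(i.+1 <= j < i.+1 + k) turn (seen A O) j.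
pose r k := nrm (seen A O (i.+1 + k)%N).
have {}E k : seen A O (i.+1 + k)%N = r k *: (cos (phi k) *: u + sin (phi k) *: v).
  exact: E.
have r0 k : 0 < r k by rewrite nrm_gt0.
have phiS k : phi k.+1 = phi k + turn (seen A O) (i.+1 + k).
  by rewrite /phi addnS big_nat_recr//= leq_addr.
have phi0 : phi 0%N = 0 by rewrite /phi addn0 big_geq.
have phi_mono p q : (p <= q)%N -> phi p <= phi q.
  move=> pq; rewrite -(subnKC pq); elim: (q - p)%N => [|m IH]; rewrite ?addn0//.
  by rewrite addnS phiS (le_trans IH)// lerDl ang_ge0.
have phin : phi n.-1 = pi.
  have := sum_cyclic n_gt0 i (turn_cyclic (seen_cyclic A_cyc O)).
  rewrite -/(total_turn n _) -/(theta n A O) tO big_ltn; last by lia.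
  rewrite (turn_edge (edge_neq i) t01) mulr2n => /addrI.
  by rewrite /phi; have -> : (i.+1 + n.-1 = i + n)%N by lia.
have phi_itv k : (k < n)%N -> 0 <= phi k <= pi.
  by move=> kn; rewrite -{1}phi0 -phin !phi_mono//; lia.
have phiB p q : (p <= q < n)%N -> 0 <= phi q - phi p <= pi.
  move=> /andP[pq qn]; have := phi_mono _ _ pq; have := phi_itv p.
  by have := phi_itv q qn; have := leq_ltn_trans pq qn => -> + /(_ isT); lra.
have ud : u = dir i.
  have := E 0%N; rewrite phi0 cos0 sin0 scale1r scale0r addr0 addn0.
  rewrite /r addn0 /O /edge_pt /dir seen_edge nrmZ gtr0_norm ?subr_gt0; last by lra.
  rewrite [nrm (A _ - _)](_ : _ = 1) ?mulr1; last by rewrite /nrm dir_unit sqrtr1.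
  by move=> /scalerI ->//; rewrite subr_eq0 gt_eqF//; lra.
have xE k : dot (seen A O (i.+1 + k)%N) (dir i) = r k * cos (phi k).
  by rewrite -ud E !dotE (dotC v) uu uv; ring.
have yE k : dot (seen A O (i.+1 + k)%N) v = r k * sin (phi k).
  by rewrite E !dotE vv uv; ring.
have [k0 k0n sk0] : exists2 k, (k < n)%N & sin (phi k) != 0.
  apply: contrapT => H; apply: (@line_noncol i O) => k kn.
  exists (r k * cos (phi k)); rewrite -ud.
  apply/eqP; rewrite addrC -subr_eq -/(seen A O _); apply/eqP.
  have s0 : sin (phi k) = 0 by apply/eqP; apply: contra_notT H => ?; exists k.
  by rewrite E s0 scale0r addr0 scalerA.
exists v; split => //; first by rewrite -ud.
(* The seen vector of [k0] and [u] are both orthogonal to [N], and the former has a nonzero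
   component along [v]. *)
- have uN : dot u N = 0 by rewrite ud dir_plane.
  have := edge_pt_plane i t (i.+1 + k0)%N.
  rewrite -/O E !dotE uN mulr0 add0r => /eqP.
  by rewrite !mulf_eq0 (negPf sk0) gt_eqF//= => /eqP.
- move=> p q pq; rewrite !xE !yE.
  rewrite [X in 0 <= X](_ : _ = r p * r q * sin (phi q - phi p)).
    by apply: mulr_ge0; [rewrite mulr_ge0// ltW|apply: sin_ge0_pi; exact: phiB].
  by rewrite sinB; ring.
- by move=> k kn; rewrite yE; apply: mulr_ge0; [rewrite ltW|apply: sin_ge0_pi; exact: phi_itv].
- move=> k kn; rewrite !xE !yE.
  rewrite [X in X = 0 -> _](_ : _ = r k * r k.+1 * sin (phi k.+1 - phi k)); last first.
    by rewrite sinB; ring.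
  rewrite [X in _ -> 0 < X](_ : _ = r k * r k.+1 * cos (phi k.+1 - phi k)); last first.
    by rewrite cosB; ring.
  move/eqP; rewrite mulf_eq0 (gt_eqF (mulr_gt0 (r0 k) (r0 k.+1))) /= => /eqP s0.
  rewrite pmulr_rgt0 ?mulr_gt0//.
  have dI : 0 <= phi k.+1 - phi k <= pi by apply: phiB; lia.
  have c1 := sin0cos1 s0.
  rewrite ltNge; apply/negP => cn; rewrite ler0_norm// in c1.
  (* Parallel but opposite neighbours would mean a jump by [pi], leaving every vertex at angle 0 or
     [pi], [k0] included. *)
  have dpi : phi k.+1 - phi k = pi.
    apply: cos_inj; rewrite ?in_itv/= ?lexx ?(ltW pi0)//.
    by rewrite cospi -c1 opprK.
  have e0 : phi k = 0 by have := phi_itv k.+1 kn; have := phi_itv k (ltnW kn); lra.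
  have e1 : phi k.+1 = pi by lra.
  case/eqP: sk0; have [le|lt] := leqP k0 k.
    have -> : phi k0 = 0.
      apply/eqP; rewrite eq_le; have /andP[-> _] := phi_itv k0 k0n.
      by rewrite -e0 phi_mono.
    exact: sin0.
  have -> : phi k0 = pi.
    by apply/eqP; rewrite eq_le; have /andP[_ ->] := phi_itv k0 k0n; rewrite -e1 phi_mono.
  exact: sinpi.
Qed.

Lemma cyclic_eqmod (T : Type) (F : nat -> T) p q :
  cyclic n F -> p = q %[mod n] -> F p = F q.
Proof. by move=> cF e; rewrite -(cyclic_mod p cF) e cyclic_mod. Qed.

Lemma exists_offset i j : exists2 k, (k < n)%N & i + k = j %[mod n].
Proof.
exists ((j + n * i - i) %% n)%N; first exact: ltn_pmod.
rewrite modnDmr (_ : (i + _ = i * n + j)%N) ?modnMDl//.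
by have := leq_pmull i n_gt0; lia.
Qed.

Lemma fan_line i t v k (O := edge_pt i t) : fan i O v ->
  dot (seen A O (i.+1 + k)) v = 0 ->
  A (i.+1 + k)%N = O + dot (seen A O (i.+1 + k)) (dir i) *: dir i.
Proof.
move=> [on vN _ _ _] y0; have := edge_pt_plane i t (i.+1 + k).
move=> /(frame_expand on (dir_plane i) vN); rewrite -/O y0 scale0r addr0.
by move=> {1}<-; rewrite /seen addrC subrK.
Qed.

(** A vertex straight ahead has polar angle 0, hence so has every earlier one; [fan_after] is the
    mirror image, with angle [pi]. *)
Lemma fan_before i O v p q : fan i O v -> (p <= q < n)%N ->
  dot (seen A O (i.+1 + q)) v = 0 -> 0 < dot (seen A O (i.+1 + q)) (dir i) ->
  dot (seen A O (i.+1 + p)) v = 0.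
Proof.
move=> [_ _ cr yge _] pq yq xq; have := cr _ _ pq.
rewrite yq mulr0 sub0r oppr_ge0 pmulr_lle0// => h.
by apply/eqP; rewrite eq_le h yge//; lia.
Qed.

Lemma fan_after i O v p q : fan i O v -> (p <= q < n)%N ->
  dot (seen A O (i.+1 + p)) v = 0 -> dot (seen A O (i.+1 + p)) (dir i) < 0 ->
  dot (seen A O (i.+1 + q)) v = 0.
Proof.
move=> [_ _ cr yge _] pq yp xp; have := cr _ _ pq.
rewrite yp mul0r subr0 nmulr_rge0// => h.
by apply/eqP; rewrite eq_le h yge//; lia.
Qed.

Lemma seen_dir i t s (P := edge_pt i s) : dot (P - edge_pt i t) (dir i) = s - t.
Proof.
by rewrite /P /edge_pt opprD addrACA subrr add0r -scalerBl dotZl dir_unit mulr1.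
Qed.

(** A point of edge [j] sees its two ends with cross product 0 and scalar product at most 0. The
    last clause of [fan] excludes this for every edge but [i]. *)
Lemma edge_disjoint i j (t s : R) : 0 < t < 1 -> off_vertices A (edge_pt i t) ->
  0 <= s <= 1 -> edge_pt i t = edge_pt j s -> j = i %[mod n].
Proof.
move=> t01 nz /andP[s0 s1] eO; have [v [_ _ _ _ acute]] := exists_fan t01 nz.
have [k kn ek] := exists_offset i.+1 j.
have [kE|k1n] : k.+1 = n \/ (k.+1 < n)%N by lia.
  by rewrite -ek addSnnS kE modnDr.
move: (acute _ k1n).
have -> : seen A (edge_pt i t) (i.+1 + k) = - (s *: dir j).
  by rewrite /seen (cyclic_eqmod A_cyc ek) eO opprD addrA subrr add0r.
have -> : seen A (edge_pt i t) (i.+1 + k.+1) = (1 - s) *: dir j.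
  rewrite /seen addnS (@cyclic_eqmod _ (fun k => A k.+1) _ _ _ ek); last first.
    by move=> r; rewrite -addSn A_cyc.
  by rewrite eO opprD addrA scalerBl scale1r.
rewrite !dotNl !dotZl; set x := dot _ _; set y := dot _ _ => H.
have : 0 < - (s * x) * ((1 - s) * x) + - (s * y) * ((1 - s) * y).
  by apply: H; ring.
rewrite (_ : _ + _ = - (s * (1 - s) * (x ^+ 2 + y ^+ 2))); last by ring.
have : 0 <= s * (1 - s) * (x ^+ 2 + y ^+ 2).
  by apply: mulr_ge0; [apply: mulr_ge0; lra|rewrite addr_ge0 ?sqr_ge0].
by rewrite oppr_gt0 => h /(le_lt_trans h); rewrite ltxx.
Qed.

Lemma fan_vertex i t s q (O := edge_pt i t) v : fan i O v ->
  A q = edge_pt i s -> forall k, i.+1 + k = q %[mod n] ->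
  dot (seen A O (i.+1 + k)) v = 0 /\
  dot (seen A O (i.+1 + k)) (dir i) = s - t.
Proof.
move=> [[_ _ uv] _ _ _ _] Aq k ek; rewrite /seen (cyclic_eqmod A_cyc ek) Aq.
split; last exact: seen_dir.
by rewrite /O /edge_pt opprD addrACA subrr add0r -scalerBl dotZl uv mulr0.
Qed.

(** From a point of the edge short of [A q] that vertex is straight ahead, so the vertices up to it
    lie on the line of the edge; from a point beyond it, the later ones do. The polygon would be
    collinear. *)
Lemma vertex_not_inside_edge i (u : R) q : 0 < u < 1 -> A q <> edge_pt i u.
Proof.
move=> /andP[u0 u1] Aq; have Ai := edge_neq i.
have [t1 /andP[t10 t1u] nz1] := exists_off_vertices n_gt0 A_cyc Ai u0.
have [t2 /andP[ut2 t21] nz2] := exists_off_vertices n_gt0 A_cyc Ai u1.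
have [|v1 f1] := exists_fan _ nz1; first by lra.
have [|v2 f2] := exists_fan _ nz2; first by lra.
have [k kn ek] := exists_offset i.+1 q.
have [y1 x1] := fan_vertex f1 Aq ek; have [y2 x2] := fan_vertex f2 Aq ek.
apply: (@line_noncol i (A i)) => l ln; have [lk|/ltnW kl] := leqP l k.
  have := fan_before (p := l) f1 _ y1; rewrite lk kn x1 subr_gt0 => /(_ isT t1u).
  by move=> /(fan_line f1) ->; rewrite -addrA -scalerDl; eexists.
have := fan_after (q := l) f2 _ y2; rewrite kl ln x2 subr_lt0 => /(_ isT ut2).
by move=> /(fan_line f2) ->; rewrite -addrA -scalerDl; eexists.
Qed.

(** From edge [i] a repetition of [A i] is straight behind, so the vertices after it, the
    predecessor of [A i] among them, lie on the line of that edge. The preceding edge is then on the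
    same line, and from there the repetition is straight ahead, so the vertices before it lie on the
    line too. *)
Lemma vertex_inj i q : A q = A i -> q = i %[mod n].
Proof.
move=> Aq; have [k kn ek] := exists_offset i.+1 q.
have [kE|k1n] : k.+1 = n \/ (k.+1 < n)%N by lia.
  by rewrite -ek addSnnS kE modnDr.
exfalso.
have [t t01 nz] := exists_off_vertices n_gt0 A_cyc (edge_neq i) ltr01.
have [v f] := exists_fan t01 nz.
have Aq0 : A q = edge_pt i 0 by rewrite /edge_pt scale0r addr0.
have [y x] := fan_vertex f Aq0 ek.
have after l : (k <= l < n)%N -> exists s, A (i.+1 + l)%N = A i + s *: dir i.
  move=> kl; have := fan_after f kl y; rewrite x sub0r oppr_lt0.
  move=> /(_ (andP t01).1) /(fan_line f) ->.
  by rewrite -addrA -scalerDl; eexists.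
(* The cyclic predecessor of [i], which also makes sense for [i = 0]. *)
pose i' := (i + n.-1)%N.
have i'S : (i'.+1 = i + n)%N by rewrite /i'; lia.
have [s Es] : exists s, A i' = A i + s *: dir i.
  have [|s E] := after n.-2; first by lia.
  by exists s; rewrite -E; congr A; rewrite /i'; lia.
have di' : dir i' = - s *: dir i.
  by rewrite {1}/dir i'S A_cyc Es opprD addrA subrr add0r scaleNr.
have [t' t'01 nz'] := exists_off_vertices n_gt0 A_cyc (edge_neq i') ltr01.
have [v' f'] := exists_fan t'01 nz'.
have Aq1 : A q = edge_pt i' 1.
  by rewrite /edge_pt scale1r /dir i'S A_cyc addrC subrK.
have ek' : i'.+1 + k.+1 = q %[mod n].
  by rewrite i'S addnAC modnDr addnS -addSn.
have [y' x'] := fan_vertex f' Aq1 ek'.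
apply: (@line_noncol i (A i)) => l ln; have [kl|lk] := leqP k l.
  by apply: after; rewrite kl.
have := fan_before (p := l.+1) f' _ y'; rewrite x' subr_gt0 (andP t'01).2.
have -> : (l < k.+1 < n)%N by lia.
move=> /(_ isT isT) /(fan_line f').
have -> : (i'.+1 + l.+1 = i.+1 + l + n)%N by lia.
rewrite A_cyc /edge_pt di' Es !scalerA -!addrA -!scalerDl => ->.
by eexists.
Qed.

Lemma fan_eqmod i j O v : i = j %[mod n] -> fan i O v -> fan j O v.
Proof.
move=> ij; rewrite /fan (cyclic_eqmod dir_cyclic ij).
suff E k : seen A O (i.+1 + k) = seen A O (j.+1 + k).
  move=> [on vN cr yge ac]; split => //.
  - by move=> p q; rewrite -!E; exact: cr.
  - by move=> k; rewrite -!E; exact: yge.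
  - by move=> k; rewrite -!E; exact: ac.
apply: (cyclic_eqmod (seen_cyclic A_cyc O)).
by apply/eqP; rewrite !addSnnS eqn_modDr; apply/eqP.
Qed.

Lemma fan_half i O v q : fan i O v -> 0 <= dot (seen A O q) v.
Proof.
move=> [_ _ _ yge _]; have [k kn ek] := exists_offset i.+1 q.
by rewrite -(cyclic_eqmod (seen_cyclic A_cyc O) ek) yge.
Qed.

Lemma fan_half_edge i O v k (s : R) : fan i O v -> 0 <= s <= 1 ->
  0 <= dot (edge_pt k s - O) v.
Proof.
move=> f /andP[s0 s1].
rewrite (_ : _ - O = (1 - s) *: seen A O k + s *: seen A O k.+1); last first.
  rewrite /edge_pt /seen /dir scalerBl scale1r -addrA -[in RHS]addrA.
  rewrite [RHS]addrC; apply/esym; rewrite addrA; apply/esym.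
  apply/rowP => j; rewrite !mxE; ring.
by rewrite dotDl !dotZl addr_ge0// mulr_ge0 ?subr_ge0//; exact: fan_half f.
Qed.

Lemma fan_up i O v : fan i O v -> dot (seen A O i) N = 0 ->
  exists2 k, (k < n)%N & 0 < dot (seen A O (i.+1 + k)) v.
Proof.
move=> [on vN _ yge _] ON; apply: contrapT => H.
apply: (@line_noncol i O) => k kn.
have y0 : dot (seen A O (i.+1 + k)) v = 0.
  apply/eqP; rewrite eq_le yge// andbT leNgt; apply/negP => y0.
  by apply: H; exists k.
have kN : dot (seen A O (i.+1 + k)) N = 0.
  rewrite -[seen A O _](subrK (seen A O i)) dotDl ON addr0.
  by rewrite /seen opprB addrA subrK A_plane.
have := frame_expand on (dir_plane i) vN kN; rewrite y0 scale0r addr0 => e.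
by exists (dot (seen A O (i.+1 + k)) (dir i)); rewrite -e addrC subrK.
Qed.

(** The height above the line of edge [m] is affine and vanishes on that line, so at [X] it is
    [1 - r] times the height of [O]. The cross product condition keeps [O] off the line, hence
    strictly inside. *)
Lemma ray_exit i (t : R) v k m (tm s r : R) vm X (O := edge_pt i t)
    (a := fun k => seen A O (i.+1 + k)%N) :
  0 < t < 1 -> fan i O v -> m = (i.+1 + k)%N ->
  dot (a k) (dir i) * dot (a k.+1) v - dot (a k) v * dot (a k.+1) (dir i) != 0 ->
  fan m (edge_pt m tm) vm -> X = O + r *: (edge_pt m s - O) ->
  0 <= dot (X - edge_pt m tm) vm -> r <= 1.
Proof.
move=> t01 f mE cr0 fm XE X0.
have hO : 0 <= dot (O - edge_pt m tm) vm by apply: (fan_half_edge _ fm); lra.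
have [[_ _ dv] vmN _ _ _] := fm; have [on _ _ _ _] := fm.
have hO0 : dot (O - edge_pt m tm) vm != 0.
  apply: contra_neq cr0 => h.
  have ON : dot (O - edge_pt m tm) N = 0.
    rewrite -(subrKA (A m)) dotDl -[A m - edge_pt m tm]/(seen A (edge_pt m tm) m).
    rewrite edge_pt_plane addr0.
    by rewrite -opprB dotNl -[A m - O]/(seen A O m) edge_pt_plane oppr0.
  have := frame_expand on (dir_plane m) vmN ON; rewrite h scale0r addr0.
  set x := dot _ _ => OE.
  have a0 : a k = - (x + tm) *: dir m.
    rewrite /a -mE /seen -(subrK (edge_pt m tm) O) OE /edge_pt.
    by apply/rowP => j; rewrite !mxE; ring.
  have a1 : a k.+1 = (1 - (x + tm)) *: dir m.
    rewrite /a addnS -mE /seen -(subrK (edge_pt m tm) O) OE /edge_pt.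
    by apply/rowP => j; rewrite /dir !mxE; ring.
  by rewrite a0 a1 !dotZl; ring.
have Y0 : dot (edge_pt m s - edge_pt m tm) vm = 0.
  by rewrite /edge_pt opprD addrACA subrr add0r -scalerBl dotZl dv mulr0.
have hX : dot (X - edge_pt m tm) vm = (1 - r) * dot (O - edge_pt m tm) vm.
  rewrite XE -[RHS]addr0 -(mulr0 r) -Y0 -!dotZl -dotDl; congr dot.
  by apply/rowP => j; rewrite !mxE; ring.
move: X0; rewrite hX; rewrite pmulr_lge0 ?subr_ge0//.
by rewrite lt_def hO0.
Qed.

(** * The region cut out by the half-planes of the edges *)

Section Region.
Variables (T : nat -> R) (V : nat -> point3 R).
Let P i := edge_pt i (T i).
Hypothesis T01 : forall i, 0 < T i < 1.
Hypothesis offV : forall i, off_vertices A (P i).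
Hypothesis fanV : forall i, fan i (P i) (V i).
Variable X : point3 R.
Hypothesis XN : dot (X - A 0%N) N = 0.
Hypothesis X_half : forall i, 0 <= dot (X - P i) (V i).

Let X_frame i : X = P i + (dot (X - P i) (dir i) *: dir i + dot (X - P i) (V i) *: V i).
Proof.
have [on vN _ _ _] := fanV i.
rewrite -(frame_expand on (dir_plane i) vN); first by rewrite addrC subrK.
rewrite -(subrKA (A 0%N)) dotDl XN add0r; exact: edge_pt_plane.
Qed.

(** The ray from [P i] through [X] passes between two consecutive vertices and leaves through the
    edge joining them; by [ray_exit] it has not gone beyond that edge at [X]. *)
Lemma region_star i : 0 < dot (X - P i) (V i) ->
  exists m s r, [/\ 0 <= s <= 1, 0 <= r <= 1 & X = P i + r *: (edge_pt m s - P i)].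
Proof.
have := X_frame i; set x := dot _ _; set y := dot _ _ => XE y0.
have [[uu vv uv] vN cr yge ac] := fanV i.
pose a k := seen A (P i) (i.+1 + k)%N.
pose xk k := dot (a k) (dir i); pose yk k := dot (a k) (V i).
have aE k : a k = xk k *: dir i + yk k *: V i.
  by apply: frame_expand => //; [exact: dir_plane|exact: edge_pt_plane].
have T0 := T01 i.
(* The cross product with [X - P i] is positive for the end of edge [i] ahead and nonpositive for
   the one behind, so it changes sign between consecutive vertices. *)
have [k [kn /= c1 c2]] : exists k, [/\ (k < n.-1)%N,
    0 < xk k * y - yk k * x & ~~ (0 < xk k.+1 * y - yk k.+1 * x)].
  apply: (@nat_crossing (fun k => 0 < xk k * y - yk k * x)).
    rewrite /xk /yk /a addn0 /P seen_edge !dotZl dir_unit uv.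
    by rewrite mulr1 mulr0 mul0r subr0 mulr_gt0//; lra.
  rewrite -leNgt /xk /yk /a (_ : (i.+1 + n.-1 = i + n)%N); last by lia.
  rewrite seen_cyclic// /P seen_edge !dotNl !dotZl dir_unit uv.
  by rewrite mulr1 mulr0 oppr0 mul0r subr0 mulNr oppr_le0 mulr_ge0//; lra.
rewrite -leNgt in c2.
set p := xk k * y - yk k * x in c1; set q := xk k.+1 * y - yk k.+1 * x in c2.
pose g := xk k * yk k.+1 - yk k * xk k.+1.
have gX : g *: (X - P i) = p *: a k.+1 - q *: a k.
  rewrite {1}XE addrC addKr !aE; apply/rowP => j; rewrite !mxE /g /p /q; ring.
(* If [g] were 0, [p *: a k.+1] and [q *: a k] would agree, though the first has a positive and the
   second a nonpositive scalar product with [a k]. *)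
have g0 : 0 < g.
  rewrite lt_def cr ?andbT; last by lia.
  apply/eqP => g0; have : 0 < xk k * xk k.+1 + yk k * yk k.+1 by apply: ac g0; lia.
  move=> d; have : dot (p *: a k.+1 - q *: a k) (a k) = 0.
    by rewrite -gX g0 scale0r dot0l.
  rewrite dotDl dotNl !dotZl => e.
  have dE : dot (a k.+1) (a k) = xk k * xk k.+1 + yk k * yk k.+1.
    by rewrite [in LHS](aE k) dotDr !dotZr.
  have : 0 < p * dot (a k.+1) (a k) by rewrite dE mulr_gt0.
  have : q * dot (a k) (a k) <= 0 by rewrite mulr_le0_ge0// dot_ge0.
  lra.
have S0 : 0 < p - q by lra.
(* Cramer's rule: dividing by [p - q] turns the weights [- q] and [p] into barycentric coordinates
   on the edge. *)
have XE' : X = P i + ((p - q) / g) *: (edge_pt (i.+1 + k) (p / (p - q)) - P i).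
  apply/eqP; rewrite addrC -subr_eq; apply/eqP.
  apply: (scalerI (lt0r_neq0 g0)); rewrite gX scalerA mulrC divfK ?gt_eqF//.
  rewrite /a /edge_pt /seen /dir addnS.
  apply/rowP => j; rewrite !mxE; field; exact: lt0r_neq0.
exists (i.+1 + k)%N, (p / (p - q)), ((p - q) / g); split => //.
  by rewrite divr_ge0/= ?ler_pdivrMr ?mul1r; lra.
apply/andP; split; first by rewrite divr_ge0// ltW.
have := @ray_exit i (T i) (V i) k _ (T (i.+1 + k)%N) (p / (p - q)) _ _ X
  (T01 i) (fanV i) erefl; apply; [|exact: fanV|exact: XE'|exact: X_half].
exact: lt0r_neq0.
Qed.

(** Because of angles [pi], [X] need not lie on edge [i] itself. The edge at which the polygon
    leaves the line bounds how far [X] can be, and two consecutive vertices on the line, or edge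
    [i], then enclose it. *)
Lemma region_line i : dot (X - P i) (V i) = 0 ->
  exists m s, 0 <= s <= 1 /\ X = edge_pt m s.
Proof.
move=> y0; have := X_frame i; rewrite y0 scale0r addr0; set x := dot _ _ => XE.
have [[uu vv uv] vN cr yge ac] := fanV i.
pose a k := seen A (P i) (i.+1 + k)%N.
pose xk k := dot (a k) (dir i); pose yk k := dot (a k) (V i).
have aE k : a k = xk k *: dir i + yk k *: V i.
  by apply: frame_expand => //; [exact: dir_plane|exact: edge_pt_plane].
have crE p q : (p <= q < n)%N -> 0 <= xk p * yk q - yk p * xk q by exact: cr.
have on_line k : yk k = 0 -> A (i.+1 + k)%N = P i + xk k *: dir i.
  move=> yk0; have := aE k; rewrite yk0 scale0r addr0 => <-.
  by rewrite /a /seen addrC subrK.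
have between k : yk k = 0 -> yk k.+1 = 0 -> xk k != xk k.+1 ->
    X = edge_pt (i.+1 + k) ((x - xk k) / (xk k.+1 - xk k)).
  move=> /on_line e0 /on_line; rewrite addnS => e1 ne.
  rewrite /edge_pt /dir e0 e1 XE opprD addrACA subrr add0r -scalerBl scalerA.
  rewrite divfK ?subr_eq0 1?eq_sym// -[RHS]addrA -scalerDl.
  by congr (_ + _ *: _); ring.
have T0 := T01 i.
have near t : x = t - T i -> X = edge_pt i t.
  move=> xt; rewrite XE xt /P /edge_pt -[LHS]addrA -scalerDl.
  by congr (_ + _ *: _); ring.
have x_neq0 k : yk k = 0 -> xk k != 0.
  move=> yk0; apply: contra_neq (offV i (i.+1 + k)%N) => xk0.
  by rewrite -/(a k) aE yk0 xk0 !scale0r addr0.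
have hN : dot (seen A (P i) i) N = 0 by exact: edge_pt_plane.
have upP : exists k, (k < n)%N && (0 < yk k).
  by have [k kn ky] := fan_up (fanV i) hN; exists k; rewrite kn.
have cross_le k (s r : R) : (k.+1 < n)%N ->
    xk k * yk k.+1 - yk k * xk k.+1 != 0 ->
    X = P i + r *: (edge_pt (i.+1 + k) s - P i) -> r <= 1.
  move=> kn c e; have := @ray_exit i (T i) (V i) k _ (T (i.+1 + k)%N) s _ _ X
    (T01 i) (fanV i) erefl; apply; [exact: c|exact: fanV|exact: e|exact: X_half].
have [x0|x0|x0] := ltgtP x 0; last first.
- by exists i, (T i); split; [lra|apply: near; lra].
(* [K] is the first vertex off the line. The half-plane of the edge ending there keeps [X] from
   passing the vertex before it. *)
- case: (ex_minnP upP) => K /andP[Kn yK] Kmin.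
  have y_lt k : (k < K)%N -> yk k = 0.
    move=> kK; apply/eqP; rewrite eq_le yge ?andbT; last by lia.
    rewrite leNgt; apply/negP => yk0; have := Kmin k; rewrite yk0 andbT; lia.
  have x_lt k : (k < K)%N -> 0 < xk k.
    move=> kK; rewrite lt_def x_neq0 ?y_lt//=.
    have := crE k K; rewrite (y_lt k kK) mul0r subr0.
    by rewrite pmulr_lge0//; apply; lia.
  have x00 : xk 0%N = 1 - T i.
    by rewrite /xk /a addn0 /P seen_edge dotZl dir_unit mulr1.
  have y00 : yk 0%N = 0 by rewrite /yk /a addn0 /P seen_edge dotZl uv mulr0.
  have K0 : (0 < K)%N by rewrite lt0n; apply/eqP => K0; rewrite K0 y00 ltxx in yK.
  have xK : x <= xk K.-1.
    have xp : 0 < xk K.-1 by apply: x_lt; lia.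
    rewrite -[xk K.-1]mul1r -ler_pdivrMr//.
    apply: (cross_le K.-1 0); rewrite ?prednK//.
      have yK1 : yk K.-1 = 0 by apply: y_lt; lia.
      by rewrite yK1 mul0r subr0; apply: mulf_neq0; exact: lt0r_neq0.
    rewrite /edge_pt scale0r addr0 on_line; last by apply: y_lt; lia.
    by rewrite [_ - P i]addrC addKr scalerA divfK ?gt_eqF.
  (* The value 0 in front stands for [P i], so a crossing at the first step places [X] on edge
     [i]. *)
  pose f l := if l is l'.+1 then xk l' else 0.
  have [||l [lK /= fl fl1]] := @nat_crossing (fun l => f l < x) K => //.
    by rewrite -leNgt /f; case: K K0 xK {Kn yK Kmin y_lt x_lt}.
  rewrite -leNgt in fl1; case: l lK fl fl1 => [|l] lK /= fl fl1.
    exists i, (x + T i); split; last by apply: near; lra.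
    by rewrite x00 in fl1; lra.
  exists (i.+1 + l)%N, ((x - xk l) / (xk l.+1 - xk l)); split.
    rewrite divr_ge0 ?ler_pdivrMr ?mul1r; lra.
  by apply: between; rewrite ?y_lt// ?lt_eqF//; [lia|lra].
have maxP k : (k < n)%N && (0 < yk k) -> (k <= n)%N by case/andP => /ltnW.
(* Behind [P i] the argument is mirrored: [K] is the last vertex off the line, and the search runs
   down from [n.-1]. *)
case: (ex_maxnP upP maxP) => K /andP[Kn yK] Kmax.
have y_gt k : (K < k < n)%N -> yk k = 0.
  move=> kK; apply/eqP; rewrite eq_le yge ?andbT; last by lia.
  rewrite leNgt; apply/negP => yk0; have := Kmax k; rewrite yk0 andbT; lia.
have x_gt k : (K < k < n)%N -> xk k < 0.
  move=> kK; rewrite lt_neqAle x_neq0 ?y_gt//=.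
  have := crE K k; rewrite (y_gt k kK) mulr0 sub0r.
  by rewrite oppr_ge0 pmulr_rle0//; apply; lia.
have iE : (i.+1 + n.-1 = i + n)%N by lia.
have xn : xk n.-1 = - T i.
  by rewrite /xk /a iE seen_cyclic// /P seen_edge dotNl dotZl dir_unit mulr1.
have yn : yk n.-1 = 0.
  by rewrite /yk /a iE seen_cyclic// /P seen_edge dotNl dotZl uv mulr0 oppr0.
have K1n : (K.+1 < n)%N.
  suff : K != n.-1 by lia.
  by apply/eqP => KE; move: yK; rewrite KE yn ltxx.
have xK : xk K.+1 <= x.
  have xp : xk K.+1 < 0 by apply: x_gt; lia.
  rewrite -[xk K.+1]mul1r -ler_ndivrMr//.
  apply: (cross_le K 1) => //.
    have yK1 : yk K.+1 = 0 by apply: y_gt; lia.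
    rewrite yK1 mulr0 sub0r oppr_eq0.
    by apply: mulf_neq0; [exact: lt0r_neq0|exact: ltr0_neq0].
  rewrite /edge_pt scale1r /dir [A _ + _]addrC subrK -addnS.
  rewrite on_line; last by apply: y_gt; lia.
  by rewrite [_ - P i]addrC addKr scalerA divfK ?lt_eqF.
pose f l := if l is l'.+1 then xk (n.-1 - l')%N else 0.
have [||l [lK /= fl fl1]] := @nat_crossing (fun l => x < f l) (n.-1 - K) => //.
  rewrite -leNgt /f (_ : (n.-1 - K = (n.-2 - K).+1)%N); last by lia.
  by rewrite (_ : (n.-1 - (n.-2 - K) = K.+1)%N)//; lia.
rewrite -leNgt in fl1; case: l lK fl fl1 => [|l] lK /= fl fl1.
  exists i, (x + T i); split; last by apply: near; lra.
  by rewrite subn0 xn in fl1; lra.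
pose q := (n.-1 - l.+1)%N; have q1 : (n.-1 - l = q.+1)%N by rewrite /q; lia.
rewrite q1 in fl; rewrite -/q in fl1.
exists (i.+1 + q)%N, ((x - xk q) / (xk q.+1 - xk q)); split.
  rewrite divr_ge0 ?ler_pdivrMr ?mul1r; lra.
apply: between; [apply: y_gt; rewrite /q; lia|apply: y_gt; rewrite /q; lia|].
by rewrite lt_eqF//; lra.
Qed.

End Region.

End Fans.

(** * Flexible curves and their energy *)

Section PiecewiseLinear.
Context {R : realType}.
Implicit Types (c : R -> point3 R) (s t x y : R) (l : seq R).

Definition chain_length c s t l : R :=
  \sum_(0 <= k < size l) dist (c (nth t (s :: l) k)) (c (nth t (s :: l) k.+1)).

Lemma chain_length_cons c s t x l :
  chain_length c s t (x :: l) = dist (c s) (c x) + chain_length c x t l.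
Proof. by rewrite /chain_length /= big_nat_recl. Qed.

Lemma chain_length1 c s t : chain_length c s t [:: t] = dist (c s) (c t).
Proof. by rewrite chain_length_cons /chain_length big_geq// addr0. Qed.

Lemma itv_partition1 s t : s < t -> itv_partition s t [:: t].
Proof. by move=> st; split; rewrite //= andbT. Qed.

Lemma dist_le_chain c s t l : itv_partition s t l ->
  dist (c s) (c t) <= chain_length c s t l.
Proof.
elim: l s => [|x l IH] s.
  move=> /itv_partition_nil ->; rewrite /chain_length big_geq// distE subrr.
  by rewrite /nrm dot0l sqrtr0.
move=> /itv_partition_cons /IH h; rewrite chain_length_cons.
by rewrite (le_trans (dist_triangle (c x) _ _))// lerD2l.
Qed.

Lemma chain_le c s t l : (forall x y, x < y -> dist (c x) (c y) <= y - x) ->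
  itv_partition s t l -> chain_length c s t l <= t - s.
Proof.
move=> lip; elim: l s => [|x l IH] s.
  by move=> /itv_partition_nil ->; rewrite /chain_length big_geq// subrr.
move=> h; have /IH IHx := itv_partition_cons h; case: h => /= /andP[sx _] _.
by rewrite chain_length_cons; have := lip _ _ sx; lra.
Qed.

Lemma flexible_dist n c s t : flexible_curve n c -> s < t ->
  dist (c s) (c t) <= t - s.
Proof.
move=> [_ len] st; rewrite -lee_fin -len//; apply: ereal_sup_ubound.
exists [:: t]; first exact: itv_partition1.
by rewrite -(chain_length1 c s t).
Qed.

(** Exact partitions make [c] 1-Lipschitz, so no partition is longer than [t - s], and the given one
    attains it. *)
Lemma flexible_of_chain n c : periodic c n%:R ->
  (forall s t, s < t -> exists2 l, itv_partition s t l &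
     chain_length c s t l = t - s) ->
  flexible_curve n c.
Proof.
move=> per ch; split => // s t st.
have lip x y : x < y -> dist (c x) (c y) <= y - x.
  by move=> /ch[l lp <-]; exact: dist_le_chain.
apply/eqP; rewrite eq_le; apply/andP; split.
  by apply: ge_ereal_sup => _ [l lp <-]; rewrite lee_fin; exact: chain_le lip lp.
have [l lp <-] := ch _ _ st; apply: ereal_sup_ubound.
by exists l.
Qed.

(** Node [Q m] is reached at time [m / 2]: the unit of time between two vertices consists of two
    pieces meeting at an auxiliary point, which allows a chord shorter than 1. *)
Definition polyline (Q : int -> point3 R) x : point3 R :=
  let m := Num.floor (2 * x) in segment_pt (Q m) (Q (m + 1)) (2 * x - m%:~R).

Lemma polyline_piece Q m x : m%:~R <= 2 * x <= (m + 1)%:~R ->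
  polyline Q x = segment_pt (Q m) (Q (m + 1)) (2 * x - m%:~R).
Proof.
move=> /andP[mx]; rewrite le_eqVlt => /predU1P[xE|xm]; last first.
  by rewrite /polyline (@floor_def _ _ m)// mx.
rewrite /polyline xE (@floor_def _ _ (m + 1)) ?ltr_int ?lexx ?ltrDl//.
have -> : (m + 1)%:~R - m%:~R = 1 :> R by rewrite intrD; ring.
by rewrite /segment_pt !subrr subr0 !scale1r !scale0r addr0 add0r.
Qed.

Lemma dist_segment_pt (P Q : point3 R) x y :
  dist (segment_pt P Q x) (segment_pt P Q y) = `|x - y| * dist P Q.
Proof.
rewrite distE (_ : _ - _ = (x - y) *: (Q - P)) ?nrmZ -?distE 1?distC//.
by rewrite /segment_pt; apply/rowP => j; rewrite !mxE; ring.
Qed.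

Lemma polyline_flexible n (Q : int -> point3 R) :
  (forall k, dist (Q k) (Q (k + 1)) = 2^-1) ->
  (forall k, Q (k + (2 * n)%:Z) = Q k) -> flexible_curve n (polyline Q).
Proof.
move=> Q1 Qn; apply: flexible_of_chain => [x|].
  have E : 2 * (x + n%:R) = 2 * x + (2 * n)%:Z%:~R by rewrite mulrDr -natrM.
  rewrite /polyline E floorDrz ?intr_int// intrKfloor.
  rewrite Qn -addrA (addrC _ 1) addrA Qn intrD; congr segment_pt; ring.
have piece (m : int) x y : x < y -> m%:~R <= 2 * x -> 2 * y <= (m + 1)%:~R ->
    dist (polyline Q x) (polyline Q y) = y - x.
  move=> xy mx ym; rewrite !(@polyline_piece Q m) ?dist_segment_pt ?Q1; try lra.
  rewrite (_ : _ - _ - _ = - (2 * (y - x))); last by ring.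
  by rewrite normrN ger0_norm; lra.
(* Induction on a bound for the number of nodes between [s] and [t]; the partition stops at each of
   them. *)
suff H K s t : s < t -> 2 * t <= (Num.floor (2 * s) + 1)%:~R + K%:R ->
    exists2 l, itv_partition s t l & chain_length (polyline Q) s t l = t - s.
  move=> s t st; have st0 : 0 <= 2 * (t - s) by lra.
  have /ltW b := archi_boundP st0; have /andP[_ b'] := floor_itv (2 * s).
  by apply: (H _ _ _ st (le_trans _ (lerD (ltW b') b))); lra.
elim: K s => [|K IH] s st h.
  exists [:: t]; first exact: itv_partition1.
  rewrite chain_length1; have /andP[b _] := floor_itv (2 * s).
  by apply: (piece (Num.floor (2 * s))) => //; lra.
set m := Num.floor (2 * s) in h; have /andP[b b'] := floor_itv (2 * s).
have [le|lt] := leP (2 * t) (m + 1)%:~R.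
  exists [:: t]; first exact: itv_partition1.
  by rewrite chain_length1; apply: (piece m).
pose x : R := (m + 1)%:~R / 2.
have x2 : 2 * x = (m + 1)%:~R by rewrite /x; field.
have sx : s < x by rewrite -/m in b'; lra.
have [||l lp lE] := IH x; first by lra.
  rewrite x2 intrKfloor (intrD _ (m + 1)); move: h; rewrite -natr1; lra.
exists (x :: l); first by case: lp => p e; split; rewrite //= sx.
by rewrite chain_length_cons lE (piece m)//; [ring|rewrite x2].
Qed.

(** Apex of the isosceles triangle with base from [P] to [Q] and legs 1/2; its height is [h], in any
    direction orthogonal to the base. *)
Lemma exists_midpoint (P Q : point3 R) : dist P Q <= 1 ->
  exists M, dist P M = 2^-1 /\ dist M Q = 2^-1.
Proof.
move=> PQ; have [e ee de] := exists_dot0 (Q - P).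
pose h := Num.sqrt (1 - dist P Q ^+ 2) / 2.
have h2 : h ^+ 2 = (1 - dist P Q ^+ 2) / 4.
  rewrite /h expr_div_n sqr_sqrtr; first by field.
  by rewrite subr_ge0 expr_le1// dist_ge0.
have [a [aE aa ae]] : exists a, [/\ a = 2^-1 *: (Q - P),
    dot a a = dist P Q ^+ 2 / 4 & dot a e = 0].
  eexists; split; first by []; last by rewrite dotZl de mulr0.
  by rewrite dotZl dotZr -nrm_sqr -distE distC; field.
have E (s : R) : s ^+ 2 = 1 -> nrm (a + (s * h) *: e) = 2^-1.
  move=> s2; rewrite -[RHS]ger0_norm ?invr_ge0 ?ler0n// -sqrtr_sqr; congr Num.sqrt.
  rewrite !dotE (dotC e a) ee ae aa.
  transitivity (dist P Q ^+ 2 / 4 + s ^+ 2 * h ^+ 2); first by ring.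
  by rewrite s2 h2; field.
exists (P + (a + h *: e)); split.
  by rewrite distC distE addrC addKr -[h]mul1r; apply: E; exact: expr1n.
rewrite distC distE -(E (-1)) ?sqrrN ?expr1n//; congr nrm.
by rewrite aE; apply/rowP => j; rewrite !mxE; field.
Qed.

Lemma exists_flexible n (B : nat -> point3 R) : (0 < n)%N -> cyclic n B ->
  (forall k, dist (B k) (B k.+1) <= 1) ->
  exists2 c, flexible_curve n c & forall i, vertex c i = B i.
Proof.
move=> n0 cB eB; have n20 : (0 < 2 * n)%N by lia.
have [M MP] := choice (fun i => exists_midpoint (eB i)).
(* The chosen midpoints need not be periodic, hence the reduction of the index. *)
pose Mc i := M (i %% n)%N.
have McP i : dist (B i) (Mc i) = 2^-1 /\ dist (Mc i) (B i.+1) = 2^-1.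
  have := MP (i %% n)%N; rewrite -/(Mc i) cyclic_mod//.
  have cS : cyclic n (fun k => B k.+1) by move=> r; rewrite -addSn cB.
  by have /= -> := cyclic_mod i cS.
pose q m := if odd m then Mc m./2 else B m./2.
have qc : cyclic (2 * n) q.
  move=> m; rewrite /q oddD oddM/= addbF halfD oddM/= andbF add0n mul2n doubleK.
  by rewrite /Mc modnDr cB.
have q1 m : dist (q m) (q m.+1) = 2^-1.
  rewrite /q /= uphalf_half; case: (odd m) => /=.
    by have [_ ] := McP m./2; rewrite add1n.
  by have [] := McP m./2; rewrite add0n.
pose Q (k : int) := q `|(k %% (2 * n)%:Z)%Z|%N.
have d0 : (2 * n)%:Z != 0 by lia.
have Qnat (m : nat) : Q m = q m by rewrite /Q modz_nat absz_nat cyclic_mod.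
have QS k : Q (k + 1) = q `|(k %% (2 * n)%:Z)%Z|.+1.
  have e : (`|(k %% (2 * n)%:Z)%Z|%N : int) = (k %% (2 * n)%:Z)%Z.
    by rewrite gez0_abs// modz_ge0.
  by rewrite -Qnat -addn1 PoszD e /Q modzDml.
exists (polyline Q).
  by apply: polyline_flexible => k; [rewrite QS q1|rewrite /Q modzDr].
move=> i; rewrite /vertex (@polyline_piece Q (2 * i)%:Z) ?lexx/=; last first.
  by rewrite -natrM intrD lexx/= lerDl.
rewrite (_ : 2 * i%:R - _ = 0); last by rewrite -natrM subrr.
rewrite /segment_pt subr0 scale1r scale0r addr0 Qnat /q.
by rewrite oddM/= mul2n doubleK.
Qed.

End PiecewiseLinear.

(** * The potential extended to 0, and sums in the extended reals *)

Section Energy.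
Context {R : realType}.
Variables (f : R -> R).
Hypothesis f_incr : {in `]0, +oo[ &, {homo f : x y / x < y}}.

Let f_le : {in `]0, +oo[ &, {homo f : x y / x <= y}}.
Proof.
move=> x y xp yp; rewrite le_eqVlt => /predU1P[->//|xy].
by apply/ltW/f_incr.
Qed.

(** By monotonicity the right limit at 0 exists and is the infimum of the values at positive reals,
    possibly [-oo]. *)
Lemma extend0_at0 (y : R) : 0 < y -> (extend0 f 0 <= (f y)%:E)%E.
Proof.
move=> y0; rewrite /extend0 eqxx.
have nd : {in `]0, +oo[ &, {homo (fun x => (f x)%:E) : u v / u <= v >-> (u <= v)%E}}.
  by move=> u v up vp uv; rewrite lee_fin f_le.
rewrite (cvg_lim _ (nondecreasing_at_right_cvge (+oo)%O isT nd))//.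
by apply: ereal_inf_lbound; exists y; rewrite //= in_itv/= y0.
Qed.

Lemma extend0_pos (x : R) : 0 < x -> extend0 f x = (f x)%:E.
Proof. by move=> x0; rewrite /extend0 gt_eqF. Qed.

Lemma extend0_lt (x y : R) : 0 <= x -> x < y -> (extend0 f x < extend0 f y)%E.
Proof.
rewrite le_eqVlt => /predU1P[<-|x0] xy; last first.
  rewrite !extend0_pos//; last exact: lt_trans xy.
  by rewrite lte_fin f_incr// in_itv/= andbT// (lt_trans x0).
(* Strictness at 0 goes through the value at [y / 2]. *)
rewrite (extend0_pos xy); apply: le_lt_trans (extend0_at0 (divr_gt0 xy (ltr0Sn _ 1))) _.
by rewrite lte_fin f_incr// ?in_itv/= ?andbT ?divr_gt0// ltr_pdivrMr// ltr_pMr// ltr1n.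
Qed.

Lemma extend0_le (x y : R) : 0 <= x -> x <= y -> (extend0 f x <= extend0 f y)%E.
Proof.
by move=> x0; rewrite le_eqVlt => /predU1P[->//|/(extend0_lt x0)/ltW].
Qed.

Lemma extend0_ltpinfty (x : R) : 0 <= x -> (extend0 f x < +oo)%E.
Proof.
move=> x0; apply: (lt_trans (@extend0_lt x (x + 1) x0 _)); first by rewrite ltrDl.
by rewrite extend0_pos ?ltry// ltr_wpDl.
Qed.

End Energy.

Section ErealSums.
Context {R : realType} {I : eqType}.
Implicit Types (F G : I -> \bar R) (s : seq I).
Local Open Scope ereal_scope.

Lemma sum_ltpinfty F s : (forall i, i \in s -> F i < +oo) -> \sum_(i <- s) F i < +oo.
Proof.
move=> h; rewrite big_seq; elim/big_ind: _ => [|x y xy yy|i /h//].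
  exact: ltry.
exact: lte_add_pinfty.
Qed.

(** A term [-oo] would absorb any difference elsewhere, hence the lower bound on the sum of [F]. The
    second conclusion allows a further application to an inner sum. *)
Lemma sum_eq_of_le F G s :
  (forall i, i \in s -> F i <= G i) -> (forall i, i \in s -> G i < +oo) ->
  -oo < \sum_(i <- s) F i -> \sum_(i <- s) G i <= \sum_(i <- s) F i ->
  forall i, i \in s -> F i = G i /\ -oo < F i.
Proof.
elim: s => // a s IH FG Goo.
have FGa := FG a (mem_head _ _); have Ga := Goo a (mem_head _ _).
have FGs i : i \in s -> F i <= G i by move=> h; apply: FG; rewrite inE h orbT.
have Gs i : i \in s -> G i < +oo by move=> h; apply: Goo; rewrite inE h orbT.
have leS : \sum_(i <- s) F i <= \sum_(i <- s) G i.
  by rewrite !big_seq; apply: lee_sum => i /FGs.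
have ltS := sum_ltpinfty Gs.
rewrite !big_cons.
have FaL : F a < +oo by exact: le_lt_trans Ga.
have FsL : \sum_(i <- s) F i < +oo by exact: le_lt_trans ltS.
move=> Foo GF; have Fa : F a \is a fin_num.
  by rewrite fin_numElt FaL andbT ltNye; apply: contraTneq Foo => ->.
have Fs : \sum_(i <- s) F i \is a fin_num.
  rewrite fin_numElt FsL andbT ltNye; apply: contraTneq Foo => ->.
  by rewrite addeC.
have aE : F a = G a.
  apply/eqP; rewrite eq_le FGa /= leNgt; apply/negP => lt.
  by move: GF; rewrite leNgt (lte_leD Fs lt leS).
have {}GF : \sum_(i <- s) G i <= \sum_(i <- s) F i by rewrite -(leeD2lE _ _ Fa) {1}aE.
move=> i; rewrite inE => /predU1P[->|/IH]; last first.
  by apply => //; move: Fs; rewrite fin_numElt => /andP[].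
by split => //; move: Fa; rewrite fin_numElt => /andP[].
Qed.

End ErealSums.

(** * Maximizers are tight *)

Section Maximizer.
Context {R : realType}.
Variables (n : nat) (f : R -> R) (c : R -> point3 R).
Hypothesis (n_gt1 : (1 < n)%N).
Hypothesis f_incr : {in `]0, +oo[ &, {homo f : x y / x < y}}.
Hypothesis c_max : energy_maximizer f n c.

Lemma vertex_cyclic (c' : R -> point3 R) : flexible_curve n c' -> cyclic n (vertex c').
Proof. by move=> [per _] k; rewrite /vertex natrD per. Qed.

Lemma vertex_edge (c' : R -> point3 R) k : flexible_curve n c' ->
  dist (vertex c' k) (vertex c' k.+1) <= 1.
Proof.
move=> fc; apply: le_trans (flexible_dist fc _) _; first by rewrite ltr_nat.
by rewrite -natr1; lra.
Qed.

(** Distinct vertices avoid the value at 0. The points [k / n] on a segment are distinct, and even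
    the closing edge is shorter than 1. *)
Lemma exists_finite_energy : exists2 c', flexible_curve n c' & (-oo < energy f n c')%E.
Proof.
have n0 : (0 < n%:R :> R) by rewrite ltr0n; lia.
have n0' : n%:R != 0 :> R by rewrite gt_eqF.
pose B k : point3 R := vec3 ((k %% n)%:R / n%:R) 0 0.
have BE p q : dist (B p) (B q) = `|(p %% n)%:R - (q %% n)%:R| / n%:R.
  rewrite distE /nrm dot3E !mxE /= !subrr !mulr0 !addr0 -expr2 sqrtr_sqr.
  by rewrite -mulrBl normrM [`|n%:R^-1|]gtr0_norm ?invr_gt0.
have Bc : cyclic n B by move=> k; rewrite /B modnDr.
have [|c' fc cE] := exists_flexible (ltnW n_gt1) Bc.
  move=> k; rewrite BE ler_pdivrMr// mul1r ler_norml.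
  have := ltn_pmod k (ltnW n_gt1); have := ltn_pmod k.+1 (ltnW n_gt1).
  rewrite -!(ltr_nat R); have := ler0n R (k %% n)%N; have := ler0n R (k.+1 %% n)%N.
  lra.
exists c' => //; rewrite /energy big_seq.
have H (x y : \bar R) : (-oo < x -> -oo < y -> -oo < x + y)%E.
  by rewrite !ltNye adde_eq_ninfty negb_or => -> ->.
elim/big_ind: _ => [|x y|p]; [exact: ltNy0|exact: H|].
rewrite mem_index_iota => pn; rewrite big_seq.
elim/big_ind: _ => [|x y|q]; [exact: ltNy0|exact: H|].
rewrite mem_index_iota => qn; rewrite extend0_pos ?ltNyr//.
rewrite !cE BE divr_gt0// normr_gt0 subr_eq0 eqr_nat.
rewrite (@modn_small p); last by lia.
have [->|qn'] := eqVneq q n; first by rewrite modnn; lia.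
by rewrite modn_small; lia.
Qed.

(** A competitor with no smaller distance has no smaller term; maximality makes all terms equal, and
    strict monotonicity the distances. *)
Lemma maximizer_tight : tight n (vertex c).
Proof.
have [fc cmax] := c_max.
move=> B cB eB AB.
have [c' fc' cE] := exists_flexible (ltnW n_gt1) cB eB.
have Aoo : (-oo < energy f n c)%E.
  have [c'' fc'' h] := exists_finite_energy.
  exact: lt_le_trans h (cmax _ fc'').
have EBA := cmax _ fc'.
pose A := vertex c.
have eq1 p q : (1 <= p)%N -> (p < q)%N -> (q <= n)%N ->
    dist (B p) (B q) = dist (A p) (A q).
  move=> p1 pq qn.
  have in_p : p \in index_iota 1 n.+1 by rewrite mem_index_iota; lia.
  have in_q : q \in index_iota p.+1 n.+1 by rewrite mem_index_iota; lia.
  have T x y : (extend0 f (dist (vertex c x) (vertex c y)) <=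
      extend0 f (dist (vertex c' x) (vertex c' y)))%E.
    by apply: extend0_le; rewrite ?dist_ge0// !cE.
  have Toop x y : (extend0 f (dist (vertex c' x) (vertex c' y)) < +oo)%E.
    by apply: extend0_ltpinfty; rewrite ?dist_ge0.
  pose F x y := extend0 f (dist (vertex c x) (vertex c y)).
  pose G x y := extend0 f (dist (vertex c' x) (vertex c' y)).
  have FG i : (\sum_(i.+1 <= j < n.+1) F i j <= \sum_(i.+1 <= j < n.+1) G i j)%E.
    by apply: lee_sum => j _; exact: T.
  have Goo i : (\sum_(i.+1 <= j < n.+1) G i j < +oo)%E.
    by apply: sum_ltpinfty => j _; exact: Toop.
  (* First the outer sum, then its row [p]: equality passes down to the single pair. *)
  have [e1 oo1] := sum_eq_of_le (fun i _ => FG i) (fun i _ => Goo i) Aoo EBA in_p.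
  have GF : (\sum_(p.+1 <= j < n.+1) G p j <= \sum_(p.+1 <= j < n.+1) F p j)%E.
    by rewrite -e1.
  have [e2 _] := sum_eq_of_le (fun j _ => T p j) (fun j _ => Toop p j) oo1 GF in_q.
  apply/eqP; rewrite eq_le AB andbT leNgt; apply/negP => lt.
  have := extend0_lt f_incr (dist_ge0 _ _) lt.
  by rewrite -!cE -e2 ltxx.
have eq2 p q : (1 <= p <= n)%N -> (1 <= q <= n)%N -> dist (B p) (B q) = dist (A p) (A q).
  move=> pn qn; have [pq|qp|->] := ltngtP p q; last 1 first.
  - by rewrite !distE !subrr.
  - by apply: eq1; lia.
  - by rewrite distC [RHS]distC; apply: eq1; lia.
have cA : cyclic n A := vertex_cyclic fc.
have rep r : exists2 r', (1 <= r' <= n)%N & B r = B r' /\ A r = A r'.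
  have rn := ltn_pmod r (ltnW n_gt1).
  have [r0|r0] := posnP (r %% n); last first.
    exists (r %% n)%N; first by rewrite r0 ltnW.
    by rewrite !cyclic_mod.
  exists n; first by lia.
  have -> : n = (0 + n)%N by [].
  by rewrite cB cA -(cyclic_mod r cB) -(cyclic_mod r cA) r0.
move=> p q; have [p' pn [-> Ap]] := rep p; have [q' qn [-> Aq]] := rep q.
by rewrite -/A Ap Aq eq2.
Qed.

End Maximizer.

(** * Traversing the boundary of the hull *)

Section Hull.
Context {R : realType}.
Implicit Types (P Q u v w : point3 R) (K V : set (point3 R)).
Local Open Scope convex_scope.

Lemma segment_ptE P Q (t : R) : segment_pt P Q t = P + t *: (Q - P).
Proof. by rewrite /segment_pt scalerBl scale1r scalerBr addrA addrAC. Qed.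

Lemma convex_setP K : @convex_set R (point3 R) K <->
  forall P Q (t : R), 0 <= t <= 1 -> K P -> K Q -> K (segment_pt P Q t).
Proof.
have convE P Q (k : {i01 R}) :
    (P : convex_lmodType (point3 R)) <| k |> Q = segment_pt Q P k%:num.
  by rewrite /segment_pt addrC.
split=> [cK P Q t t01 KP KQ|H P Q k /set_mem KP /set_mem KQ].
  have [t0 t1] := andP t01.
  pose k : {i01 R} := @Itv01 R t t0 t1.
  have /set_mem := cK Q P k (mem_set KQ) (mem_set KP).
  by rewrite convE.
by apply/mem_set; rewrite convE; apply: H => //; rewrite ge0 le1.
Qed.

Lemma sub_hull V : V `<=` convex_hull V.
Proof. exact: sub_gen_smallest. Qed.

Lemma hull_sub V K : @convex_set R (point3 R) K -> V `<=` K -> convex_hull V `<=` K.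
Proof. by move=> cK VK; exact: smallest_sub. Qed.

Lemma hull_segment V P Q (t : R) : 0 <= t <= 1 ->
  convex_hull V P -> convex_hull V Q -> convex_hull V (segment_pt P Q t).
Proof.
move=> t01 VP VQ K [cK VK].
by apply: (convex_setP K).1 => //; [exact: VP|exact: VQ].
Qed.

Lemma convex_halfspace P v : @convex_set R (point3 R) [set X | 0 <= dot (X - P) v].
Proof.
apply/convex_setP => X Y t /andP[t0 t1] /= hX hY.
rewrite (_ : _ - P = (1 - t) *: (X - P) + t *: (Y - P)).
  by rewrite dotDl !dotZl addr_ge0// mulr_ge0// subr_ge0.
by rewrite /segment_pt; apply/rowP => j; rewrite !mxE; ring.
Qed.

Lemma convex_segment P Q : @convex_set R (point3 R) (segment P Q).
Proof.
apply/convex_setP => _ _ t /andP[t0 t1] [x xI <-] [y yI <-].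
move: xI yI; rewrite /= !in_itv/= => /andP[x0 x1] /andP[y0 y1].
exists ((1 - t) * x + t * y); rewrite /= ?in_itv/=.
  apply/andP; split.
    by rewrite addr_ge0// mulr_ge0// subr_ge0.
  rewrite -[leRHS](subrK t); apply: lerD.
    by rewrite ler_piMr// subr_ge0.
  by rewrite ler_piMr.
by rewrite /segment_pt; apply/rowP => j; rewrite !mxE; ring.
Qed.

Lemma is_plane_orthonormal P u v : orthonormal2 u v ->
  is_plane [set P + x.1 *: u + x.2 *: v | x in [set: R * R]].
Proof.
move=> [uu vv uv]; exists P, u, v; split => //.
rewrite free_cons span_seq1 seq1_free; apply/andP; split.
  apply/negP => /vlineP[k uE]; move: uv; rewrite uE dotZl vv mulr1 => k0.
  by move: uu; rewrite uE k0 scale0r dot0l => /esym/eqP; rewrite oner_eq0.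
by rewrite -dot_eq0 vv oner_eq0.
Qed.

(** Stewart's identity [|m - u d|^2 = (1 - u) |m|^2 + u |m - d|^2 - u (1 - u) |d|^2] with
    [m = M - P] and [d = Q - P]: the bounds make the right side at most 0. *)
Lemma edge_point P Q M (u : R) : 0 <= u <= 1 -> dist P Q = 1 ->
  dist P M <= u -> dist M Q <= 1 - u -> M = segment_pt P Q u.
Proof.
move=> /andP[u0 u1] PQ PM MQ; rewrite segment_ptE.
apply/eqP; rewrite -subr_eq0 -dot_eq0 eq_le dot_ge0 andbT.
have h1 : dist P M ^+ 2 <= u ^+ 2 by rewrite ler_pXn2r ?nnegrE ?dist_ge0.
have h2 : dist M Q ^+ 2 <= (1 - u) ^+ 2.
  by rewrite ler_pXn2r ?nnegrE ?dist_ge0// subr_ge0.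
have h3 : dist P Q ^+ 2 = 1 by rewrite PQ expr1n.
move: h1 h2 h3; rewrite !distE !nrm_sqr.
rewrite -[dot (P - M) _]opprK -dotNl -dotNr opprB.
rewrite -[dot (P - Q) _]opprK -dotNl -dotNr opprB.
have -> : M - Q = (M - P) - (Q - P) by rewrite opprB addrA subrK.
have -> : M - (P + u *: (Q - P)) = (M - P) - u *: (Q - P) by rewrite opprD addrA.
move: (M - P) (Q - P) => m d; rewrite !dotE (dotC d m).
move: (dot m m) (dot m d) (dot d d) => mm md dd h1 h2 h3.
have : (1 - u) * (mm - u ^+ 2) <= 0 by rewrite mulr_ge0_le0 ?subr_ge0 ?subr_le0.
have : 0 <= u * ((1 - u) ^+ 2 - (mm - md - (md - dd))).
  by rewrite mulr_ge0//; lra.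
rewrite h3; nra.
Qed.

End Hull.

(** * The curve runs along straight unit edges; collinear polygons *)

Section Polygon.
Context {R : realType}.
Variables (n : nat) (c : R -> point3 R).
Hypotheses (n_gt1 : (1 < n)%N) (c_flex : flexible_curve n c).
Hypothesis (c_tight : tight n (vertex c)).

Let A := vertex c.
Let V : set (point3 R) := [set A i | i in [set i | (1 <= i <= n)%N]].
Let n_gt0 : (0 < n)%N := ltnW n_gt1.
Let A_cyc : cyclic n A := vertex_cyclic c_flex.
Let A_edge k : dist (A k) (A k.+1) <= 1 := vertex_edge k c_flex.

Lemma polygon_edge1 k : dist (A k) (A k.+1) = 1.
Proof. exact: (tight_unit_edges n_gt1 A_cyc A_edge c_tight). Qed.

(** A 1-Lipschitz curve has no slack when it covers distance 1 in unit time. *)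
Lemma polygon_edge k (u : R) : 0 <= u <= 1 ->
  c (k%:R + u) = segment_pt (A k) (A k.+1) u.
Proof.
move=> u01; have /andP[u0 u1] := u01.
apply: edge_point => //; first exact: polygon_edge1.
  move: u0; rewrite le_eqVlt => /predU1P[<-|u0].
    by rewrite addr0 distE subrr /nrm dot0l sqrtr0.
  rewrite [leRHS](_ : _ = (k%:R + u) - k%:R); last by ring.
  by apply: (flexible_dist c_flex); rewrite ltrDl.
move: u1; rewrite le_eqVlt => /predU1P[->|u1].
  by rewrite natr1 /A /vertex distE !subrr /nrm dot0l sqrtr0.
rewrite (_ : 1 - u = k.+1%:R - (k%:R + u)); last by rewrite -natr1; ring.
by apply: (flexible_dist c_flex); rewrite -natr1 ltrD2l.
Qed.

Lemma polygon_vertex_in k : V (A k).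
Proof.
have kn := ltn_pmod k n_gt0; have [k0|k0] := posnP (k %% n); last first.
  by exists (k %% n)%N; [rewrite /= k0 ltnW|rewrite cyclic_mod].
by exists n; [rewrite /= n_gt0 leqnn|rewrite -(cyclic_mod n A_cyc) modnn -k0 cyclic_mod].
Qed.

Lemma polygon_ngon H g : is_plane H -> V `<=` H ->
  boundary_traversal H (convex_hull V) g -> in_cyclic_order n A g ->
  convex_unit_ngon n c.
Proof.
move=> pH VH bt co; split.
- by move=> i _; exact: polygon_edge1.
- by move=> i u _; exact: polygon_edge.
- by exists H; split => //; exists g.
Qed.

(** The vertices come at times [(i - m) / n], spread over less than one period. The shift [m] serves
    the collinear case, where the traversal must start at an end of the segment. *)
Lemma polygon_order (m : nat) :
  in_cyclic_order n A (fun s => c (n%:R * s + m%:R)).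
Proof.
have n0 : 0 < n%:R :> R by rewrite ltr0n.
exists (fun i => (i%:R - m%:R) / n%:R); split.
- by move=> i _; rewrite ltr_pM2r ?invr_gt0// ltrD2r ltr_nat.
- rewrite ltr_pdivrMr// mulrDl divfK ?gt_eqF// mul1r.
  by rewrite (_ : 1%:R = 1)//; lra.
- by move=> i _; rewrite mulrC divfK ?gt_eqF// subrK.
Qed.

Section Collinear.
Variables (x : nat -> R) (e : point3 R).
Hypothesis ee : dot e e = 1.
Hypothesis A_line : forall k, A k = A 0%N + x k *: e.

Let x_cyc : cyclic n x.
Proof.
move=> k; have := A_cyc k; rewrite A_line (A_line k) => /addrI h.
by rewrite -[LHS]mulr1 -[RHS]mulr1 -ee -!dotZl h.
Qed.

Let x_step k : x k.+1 = x k + 1 \/ x k.+1 = x k - 1.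
Proof.
have := polygon_edge1 k; rewrite distE A_line (A_line k.+1) opprD addrACA subrr add0r.
rewrite -scalerBl nrmZ /nrm ee sqrtr1 mulr1.
have [h|h] := lerP 0 (x k - x k.+1); first by rewrite ger0_norm//; right; lra.
by rewrite ltr0_norm//; left; lra.
Qed.

Let seen_line k (t : R) q : seen A (A k + t *: (A k.+1 - A k)) q =
  (x q - (x k + t * (x k.+1 - x k))) *: e.
Proof.
rewrite /seen (A_line q) (A_line k) (A_line k.+1).
by apply/rowP => j; rewrite !mxE; ring.
Qed.

Let ang_line (a b : R) : a * b < 0 -> ang (a *: e) (b *: e) = pi.
Proof.
move=> ab; have a0 : a != 0 by apply: contraTneq ab => ->; rewrite mul0r ltxx.
have -> : b *: e = - ((- b / a) *: (a *: e)).
  by rewrite scalerA divfK// scaleNr opprK.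
apply: ang_opp; first by rewrite scaler_eq0 (negPf a0)/= -dot_eq0 ee oner_eq0.
rewrite (_ : - b / a = - (a * b) / a ^+ 2); last by field.
by rewrite divr_gt0 ?oppr_gt0// exprn_even_gt0.
Qed.

(* If the direction changed at edge [k] between [p] and [q], a point of that
   edge would see three half turns. *)
Let no_zigzag p q k : (p <= k < q)%N -> (q <= p + n)%N ->
  (x k.+1 - x k) * (x p - x k.+1) >= 0 -> (x k.+1 - x k) * (x k - x q) >= 0 ->
  False.
Proof.
move=> /andP[pk kq] qpn h1 h2; have pi0 := @pi_gt0 R.
have Ak : A k != A k.+1 by rewrite -dist_eq0 polygon_edge1 oner_eq0.
have [t t01 nz] := exists_off_vertices n_gt0 A_cyc Ak ltr01.
have [N NN eN] := exists_dot0 e.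
set O := A k + _ in nz.
have ON : in_plane A N O by move=> r; rewrite seen_line dotZl eN mulr0.
have := theta_in_plane n_gt0 A_cyc A_edge c_tight NN ON nz
  (theta_edge_ge n_gt0 A_cyc Ak t01 nz).
(* The half turns are those from [p] to [k], along edge [k], and from [k.+1] to [q]. *)
rewrite /theta /total_turn -(sum_cyclic n_gt0 p (turn_cyclic (seen_cyclic A_cyc O))).
rewrite (@big_cat_nat _ _ _ k)//=; last by lia.
rewrite (@big_ltn _ _ _ k)/=; last by lia.
rewrite (@big_cat_nat _ _ _ q k.+1 (p + n))//=.
rewrite (turn_edge Ak t01).
have := ang_le_sum_turn nz pk; have := ang_le_sum_turn nz kq.
have : 0 <= \sum_(q <= i < p + n) turn (seen A O) i.
  by apply: sumr_ge0 => i _; exact: ang_ge0.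
have d2 : (x k.+1 - x k) ^+ 2 = 1 by case: (x_step k) => ->; ring.
rewrite !seen_line !ang_line; last 2 first.
- rewrite [ltLHS](_ : _ = - (t * ((x k.+1 - x k) * (x p - x k.+1) +
    (1 - t) * (x k.+1 - x k) ^+ 2))); last by ring.
  by rewrite d2 oppr_lt0 mulr_gt0//; lra.
- rewrite [ltLHS](_ : _ = - ((1 - t) * ((x k.+1 - x k) * (x k - x q) +
    t * (x k.+1 - x k) ^+ 2))); last by ring.
  by rewrite d2 oppr_lt0 mulr_gt0//; lra.
by rewrite mulr2n; lra.
Qed.

(** On the way from a lowest vertex [m] to a highest one [m + L] a step down would be a zigzag, and
    on the way back a step up; so the coordinate rises [L] times and then only falls. *)
Lemma polygon_collinear : convex_unit_ngon n c.
Proof.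
have [m0 _ mmin] := arg_minP (fun k : 'I_n => x k) (isT : predT (Ordinal n_gt0)).
have [j0 _ jmax] := arg_maxP (fun k : 'I_n => x k) (isT : predT (Ordinal n_gt0)).
pose m : nat := m0.
have {}mmin k : x m <= x k.
  by rewrite -(cyclic_mod k x_cyc); exact: (mmin (Ordinal (ltn_pmod k n_gt0))).
have [L Ln mL] := exists_offset n_gt1 m j0.
have {}jmax k : x k <= x (m + L)%N.
  rewrite (cyclic_eqmod x_cyc mL) -(cyclic_mod k x_cyc).
  exact: (jmax (Ordinal (ltn_pmod k n_gt0))).
have up k : (k < L)%N -> x (m + k).+1 = x (m + k)%N + 1.
  move=> kL; case: (x_step (m + k)) => // E; exfalso.
  apply: (@no_zigzag m (m + L) (m + k)); rewrite ?E; [lia|lia| |].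
    by have := mmin (m + k).+1; rewrite E; lra.
  by have := jmax (m + k)%N; lra.
have down k : (L <= k < n)%N -> x (m + k).+1 = x (m + k)%N - 1.
  move=> kL; case: (x_step (m + k)) => // E; exfalso.
  apply: (@no_zigzag (m + L) (m + n) (m + k)); rewrite ?E; [lia|lia| |].
    by have := jmax (m + k).+1; rewrite E; lra.
  by have := mmin (m + k)%N; rewrite x_cyc; lra.
have xup k : (k <= L)%N -> x (m + k)%N = x m + k%:R.
  elim: k => [|k IH] kL; first by rewrite addn0 addr0.
  by rewrite addnS up// IH 1?ltnW// -natr1 addrA.
have xdown k : (L + k <= n)%N -> x (m + L + k)%N = x m + L%:R - k%:R.
  elim: k => [|k IH] kL; first by rewrite addn0 subr0 xup.
  rewrite -addnA !addnS down ?addnA ?IH; [|lia|lia].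
  by rewrite -natr1; ring.
(* The rise by [L] and the fall by [n - L] cancel over one period. *)
have nL : n = (L + L)%N.
  apply/eqP; rewrite -(eqr_nat R) natrD.
  have := xdown (n - L)%N; rewrite -addnA subnKC ?x_cyc ?natrB; try by lia.
  by move=> /(_ (leqnn _)) h; apply/eqP; lra.
have L0 : (0 < L)%N by lia.
have L0R : 0 < L%:R :> R by rewrite ltr0n.
have nR : n%:R = L%:R * 2 :> R by rewrite nL natrD; ring.
have c_edge k (u : R) : 0 <= u <= 1 ->
    c (k%:R + u) = A 0%N + (x k + u * (x k.+1 - x k)) *: e.
  move=> u01; rewrite polygon_edge// segment_ptE (A_line k) (A_line k.+1).
  by apply/rowP => j; rewrite !mxE; ring.
have cup (u : R) : 0 <= u <= L%:R -> c (m%:R + u) = A 0%N + (x m + u) *: e.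
  move=> /andP[u0]; rewrite le_eqVlt => /predU1P[->|uL].
    by rewrite -natrD -xup// -A_line.
  have /andP[k1 k2] := truncn_itv u0; set k := Num.truncn u in k1 k2.
  have kL : (k < L)%N by rewrite -(ltr_nat R); exact: le_lt_trans uL.
  rewrite (_ : m%:R + u = (m + k)%:R + (u - k%:R)); last by rewrite natrD; ring.
  rewrite c_edge ?up// ?xup 1?ltnW//; last by rewrite -natr1 in k2; lra.
  by congr (_ + _ *: _); ring.
have cdown (u : R) : 0 <= u <= L%:R ->
    c ((m + L)%:R + u) = A 0%N + (x m + L%:R - u) *: e.
  move=> /andP[u0]; rewrite le_eqVlt => /predU1P[->|uL].
    by rewrite -natrD -xdown -?A_line//; lia.
  have /andP[k1 k2] := truncn_itv u0; set k := Num.truncn u in k1 k2.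
  have kL : (k < L)%N by rewrite -(ltr_nat R); exact: le_lt_trans uL.
  rewrite (_ : _ + u = (m + L + k)%:R + (u - k%:R)); last by rewrite !natrD; ring.
  rewrite c_edge; last by rewrite -natr1 in k2; lra.
  rewrite -addnS !xdown; [|lia|lia].
  by congr (_ + _ *: _); rewrite -natr1; ring.
have seg (t : R) : segment_pt (A m) (A (m + L)%N) t = A 0%N + (x m + t * L%:R) *: e.
  rewrite segment_ptE (A_line m) (A_line (m + L)%N) xup//.
  by apply/rowP => j; rewrite !mxE; ring.
have [v vv ev] := exists_dot0 e.
apply: (polygon_ngon (is_plane_orthonormal (A 0%N) (And3 ee vv ev)) _ _
  (polygon_order m)).
  move=> _ [k _ <-]; exists (x k, 0) => //=.
  by rewrite scale0r addr0 -A_line.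
split.
  move=> s; rewrite mulrDr mulr1 addrAC; have [per _] := c_flex; exact: per.
right; exists (A m), (A (m + L)%N); split.
  apply/seteqP; split.
    apply: hull_sub; first exact: convex_segment.
    move=> _ [k _ <-]; exists ((x k - x m) / L%:R).
      rewrite /= in_itv/= divr_ge0 ?ler_pdivrMr ?mul1r ?subr_ge0 ?ler0n//=.
      by have := jmax k; rewrite xup//; lra.
    rewrite seg divfK ?gt_eqF//; rewrite [x m + _]addrC subrK.
    exact/esym/A_line.
  move=> _ [t tI <-]; apply: hull_segment; first by move: tI; rewrite /= in_itv.
    by apply: sub_hull; exact: polygon_vertex_in.
  by apply: sub_hull; exact: polygon_vertex_in.
move=> s /andP[s0 s1]; rewrite !seg nR; split.
  rewrite addrC cup; first by congr (_ + _ *: _); ring.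
  by apply/andP; split; nra.
rewrite (_ : _ + m%:R = (m + L)%:R + (L%:R - L%:R * 2 * s)); last by rewrite natrD; ring.
rewrite cdown; first by congr (_ + _ *: _); ring.
by apply/andP; split; nra.
Qed.

End Collinear.

End Polygon.

(** * Closed half-spaces and continuity of Lipschitz curves *)

Section Topology.
Context {R : realType}.

Lemma continuous_dot_sub (P v : point3 R) : continuous (fun X : point3 R => dot (X - P) v).
Proof.
move=> X; rewrite (_ : (fun X => _) = fun X : point3 R =>
    X 0 0 * v 0 0 + X 0 1 * v 0 1 + X 0 2%:R * v 0 2%:R - dot P v); last first.
  by apply/funext => Y; rewrite !dot3E !mxE; ring.
have C (j : 'I_3) : {for X, continuous (fun Y : point3 R => Y 0 j * v 0 j)}.
  apply: continuousM; first exact: (@coord_continuous R 1 3 0 j X).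
  exact: cst_continuous.
have K : {for X, continuous (fun _ : point3 R => - dot P v)} by exact: cst_continuous.
exact: (continuousD (continuousD (continuousD (C 0) (C 1)) (C 2%:R)) K).
Qed.

Lemma closure_ge0 (C : set (point3 R)) (P v X : point3 R) :
  C `<=` [set Y | 0 <= dot (Y - P) v] -> closure C X -> 0 <= dot (X - P) v.
Proof.
move=> CP clX; rewrite leNgt; apply/negP => lt.
have [Y [CY /= Ylt]] : C `&` [set Y | dot (Y - P) v < 0] !=set0.
  by apply: clX; exact: (@continuous_dot_sub P v X _ (lt_nbhsl lt)).
by have := CP _ CY; rewrite /= leNgt Ylt.
Qed.

Lemma coord_le_nrm (P : point3 R) j : `|P 0 j| <= nrm P.
Proof.
rewrite -sqrtr_sqr ler_sqrt ?dot_ge0// /dot (bigD1 j)//= -expr2 lerDl.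
by apply: sumr_ge0 => i _; rewrite -expr2 sqr_ge0.
Qed.

Lemma cvg_coord (T : Type) (F : set_system T) {FF : Filter F}
    (h : T -> point3 R) (X : point3 R) :
  (forall j, h t 0 j @[t --> F] --> X 0 j) -> h t @[t --> F] --> X.
Proof.
move=> hX B [Q QX QB]; rewrite /nbhs/=.
have : \forall t \near F, forall j, Q 0 j (h t 0 j).
  by apply: filter_forall => j; exact: (hX j _ (QX 0 j)).
by apply: filterS => t Qt; apply: QB => i j; rewrite (ord1 i).
Qed.

Lemma continuous_lipschitz (h : R -> point3 R) (k : R) : 0 < k ->
  (forall s t, s < t -> dist (h s) (h t) <= k * (t - s)) -> continuous h.
Proof.
move=> k0 lip s; apply: cvg_coord => j; apply/cvgrPdist_lt => eps eps0.
have lip' t : dist (h s) (h t) <= k * `|s - t|.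
  have [st|ts|->] := ltgtP s t; last first.
  - by rewrite distE !subrr normr0 mulr0 /nrm dot0l sqrtr0.
  - by rewrite distC ger0_norm ?subr_ge0 ?lip// ltW.
  - by rewrite ler0_norm ?subr_le0 ?opprB ?lip// ltW.
near=> t; apply: le_lt_trans (_ : k * `|s - t| < eps).
  apply: le_trans (lip' t); rewrite distE.
  by apply: le_trans (coord_le_nrm _ j); rewrite !mxE.
rewrite mulrC -ltr_pdivlMr//; near: t.
exact: (nbhsx_ballx s (eps / k) (divr_gt0 eps0 k0)).
Unshelve. all: by end_near.
Qed.

End Topology.

(** * Noncollinear polygons: the edges trace the boundary of the hull *)

Section Noncollinear.
Context {R : realType}.
Variables (n : nat) (c : R -> point3 R).
Hypotheses (n_gt1 : (1 < n)%N) (c_flex : flexible_curve n c).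
Hypothesis (c_tight : tight n (vertex c)).

Let A := vertex c.
Let V : set (point3 R) := [set A i | i in [set i | (1 <= i <= n)%N]].
Let n_gt0 : (0 < n)%N := ltnW n_gt1.
Let A_cyc : cyclic n A := vertex_cyclic c_flex.
Let A_edge k : dist (A k) (A k.+1) <= 1 := vertex_edge k c_flex.

Hypothesis A_noncol :
  ~ exists P v : point3 R, forall k, exists s, A k = P + s *: v.

Let g (s : R) := c (n%:R * s + 0%:R).
Let nR : 0 < n%:R :> R. Proof. by rewrite ltr0n. Qed.

Let c_edge k (u : R) : 0 <= u <= 1 -> c (k%:R + u) = edge_pt A k u.
Proof. by move=> u01; rewrite (polygon_edge n_gt1 c_flex c_tight)// segment_ptE. Qed.

Let g_per : periodic g 1.
Proof.
move=> s; rewrite /g mulrDr mulr1 addrAC; have [per _] := c_flex; exact: per.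
Qed.

Let g_edge (s : R) : 0 <= s < 1 -> exists i u,
  [/\ (i < n)%N, 0 <= u < 1, n%:R * s = i%:R + u & g s = edge_pt A i u].
Proof.
move=> /andP[s0 s1].
have ns0 : 0 <= n%:R * s by rewrite mulr_ge0// ltW.
have /andP[i1 i2] := truncn_itv ns0; set i := Num.truncn _ in i1 i2.
exists i, (n%:R * s - i%:R).
have iE : n%:R * s = i%:R + (n%:R * s - i%:R) by rewrite addrC subrK.
split => //.
- rewrite -(ltr_nat R); apply: (le_lt_trans i1).
  by rewrite -[ltRHS]mulr1 ltr_pM2l.
- by rewrite -natr1 in i2; lra.
- rewrite /g addr0 {1}iE c_edge//.
  by rewrite -natr1 in i2; lra.
Qed.

Let g_floor (s : R) : g s = g (s - (Num.floor s)%:~R).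
Proof.
have H (k : nat) (x : R) : g (x + k%:R) = g x.
  by rewrite -[k%:R]/(1 *+ k) periodicn.
case: (Num.floor s) => k.
  by rewrite -[in LHS](subrK k%:R s) H.
by rewrite NegzE mulrNz opprK H.
Qed.

(** The hull is the region [D]: half-planes are convex, and conversely [region_star] and
    [region_line] express points of [D] through edge points. Where one of the half-plane
    inequalities becomes an equality, [region_line] finds an edge; so the boundary is the union of
    the edges. *)
Lemma polygon_noncollinear : convex_unit_ngon n c.
Proof.
have A01 : A 0%N != A 1%N by rewrite -dist_eq0 (polygon_edge1 n_gt1 c_flex c_tight) oner_eq0.
have [N NN AN] := tight_planar n_gt0 A_cyc A_edge c_tight A01.
have fans i : exists tv : R * point3 R, [/\ 0 < tv.1 < 1,
    off_vertices A (edge_pt A i tv.1) & fan n A N i (edge_pt A i tv.1) tv.2].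
  have Ai : A i != A i.+1 by rewrite -dist_eq0 (polygon_edge1 n_gt1 c_flex c_tight) oner_eq0.
  have [t t01 nz] := exists_off_vertices n_gt0 A_cyc Ai ltr01.
  have [v fv] := exists_fan n_gt1 A_cyc A_edge c_tight NN AN A_noncol t01 nz.
  by exists (t, v).
have [F FP] := choice fans.
(* Reduction modulo [n] leaves finitely many half-planes, so that strict inequalities persist in a
   neighbourhood. *)
pose T i := (F (i %% n)%N).1; pose W i := (F (i %% n)%N).2.
pose P i := edge_pt A i (T i).
have edge_mod i t : edge_pt A (i %% n) t = edge_pt A i t.
  exact: (cyclic_mod i (edge_pt_cyclic A_cyc t)).
have T01 i : 0 < T i < 1 by have [] := FP (i %% n)%N.
have offP i : off_vertices A (P i).
  by have [_ + _] := FP (i %% n)%N; rewrite edge_mod.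
have fanP i : fan n A N i (P i) (W i).
  have [_ _] := FP (i %% n)%N; rewrite edge_mod.
  by apply: (fan_eqmod A_cyc); rewrite modn_mod.
pose D X := dot (X - A 0%N) N = 0 /\ forall i, 0 <= dot (X - P i) (W i).
have edge_hull k (s : R) : 0 <= s <= 1 -> convex_hull V (edge_pt A k s).
  move=> s01; rewrite /edge_pt -segment_ptE.
  by apply: hull_segment => //; apply: sub_hull; exact: polygon_vertex_in.
have hullH (Q w : point3 R) : (forall k, 0 <= dot (A k - Q) w) ->
    convex_hull V `<=` [set X | 0 <= dot (X - Q) w].
  move=> h; apply: hull_sub; first exact: convex_halfspace.
  by move=> _ [k _ <-]; exact: h.
have hullW i : convex_hull V `<=` [set X | 0 <= dot (X - P i) (W i)].
  by apply: hullH => k; exact: (fan_half n_gt1 A_cyc _ (fanP i)).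
have hullN : convex_hull V `<=` [set X | 0 <= dot (X - A 0%N) N].
  by apply: hullH => k; rewrite AN.
have hullN' : convex_hull V `<=` [set X | 0 <= dot (X - A 0%N) (- N)].
  by apply: hullH => k; rewrite dotNr AN oppr0.
have region X i : D X -> dot (X - P i) (W i) = 0 ->
    exists m s, 0 <= s <= 1 /\ X = edge_pt A m s.
  move=> [XN XW]; exact: (region_line n_gt1 A_cyc A_edge c_tight NN AN A_noncol
    T01 offP fanP XN XW).
have Dhull X : D X -> convex_hull V X.
  move=> DX; have [XN XW] := DX; have := XW 0%N.
  rewrite le_eqVlt => /predU1P[/esym/(region _ _ DX)[m [s [s01 ->]]]|]; first exact: edge_hull.
  move=> /(region_star n_gt1 A_cyc A_edge c_tight NN AN T01 fanP XN XW).
  move=> [m [s [r [s01 r01 ->]]]]; rewrite -segment_ptE.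
  apply: hull_segment => //; apply: edge_hull => //.
  by have := T01 0%N; lra.
pose H : set (point3 R) :=
  [set A 0%N + x.1 *: dir A 0 + x.2 *: W 0%N | x in [set: R * R]].
have [on0 W0N _ _ _] := fanP 0%N.
have HE X : H X <-> dot (X - A 0%N) N = 0.
  split=> [[x _ <-]|XN].
    rewrite (addrC _ (- A 0%N)) !addrA addNr add0r dotDl !dotZl W0N [dot (dir A 0) N]AN.
    by rewrite !mulr0 addr0.
  exists (dot (X - A 0%N) (dir A 0), dot (X - A 0%N) (W 0%N)) => //=.
  rewrite -addrA -(frame_expand NN on0 (AN _ _) W0N XN).
  by rewrite addrC subrK.
have VH : V `<=` H by move=> _ [k _ <-]; apply/HE; exact: AN.
have boundary_edge X : boundary_in H (convex_hull V) X ->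
    exists m s, 0 <= s <= 1 /\ X = edge_pt A m s.
  move=> [clC clH].
  have XN : dot (X - A 0%N) N = 0.
    apply/eqP; rewrite eq_le (closure_ge0 hullN clC) andbT.
    by have := closure_ge0 hullN' clC; rewrite dotNr oppr_ge0.
  have XW i : 0 <= dot (X - P i) (W i) by exact: closure_ge0 (hullW i) clC.
  (* Off all edges the inequalities are strict, so nearby points of the plane stay in [D], hence in
     the hull, and [X] is no boundary point. *)
  apply: contrapT => nX.
  have X0 i : 0 < dot (X - P i) (W i).
    rewrite lt_def XW andbT; apply/eqP => X0; apply: nX.
    exact: (region X i).
  have : \forall Y \near X, forall i : 'I_n, 0 < dot (Y - P i) (W i).
    have nb (i : 'I_n) : nbhs X [set Y | 0 < dot (Y - P i) (W i)].
      exact: (@continuous_dot_sub R (P i) (W i) X _ (lt_nbhsr (X0 i))).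
    have FX : Filter (nbhs (X : 'rV[R]_3)) by exact: nbhs_filter.
    exact: (@filter_forall _ _ _ (nbhs (X : 'rV[R]_3)) FX nb).
  move=> /clH[Y [[/HE YN YC] YW]]; apply: YC; apply: Dhull; split => // i.
  have := YW (Ordinal (ltn_pmod i n_gt0)); rewrite /= /P edge_mod /T /W !modn_mod.
  exact: ltW.
have edge_boundary m (s : R) : 0 <= s <= 1 ->
    boundary_in H (convex_hull V) (edge_pt A m s).
  move=> s01; split.
    move=> B /nbhs_singleton BX; exists (edge_pt A m s); split => //.
    exact: edge_hull.
  (* Pushing the point against [W m] leaves the half-plane of edge [m] at once. *)
  move=> B nB; have [[_ ww dw] WN _ _ _] := fanP m.
  have nE : \forall e \near (0 : R), B (edge_pt A m s + e *: - W m).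
    have : edge_pt A m s + e *: - W m @[e --> (0 : R)] --> edge_pt A m s.
      apply: cvg_coord => j.
      have K : {for (0 : R), continuous (fun e : R => edge_pt A m s 0 j + e * - W m 0 j)}.
        apply: continuousD; first exact: cst_continuous.
        apply: continuousM; [exact: cvg_id|exact: cst_continuous].
      rewrite [X in _ --> X](_ : _ = edge_pt A m s 0 j + 0 * - W m 0 j); last first.
        by rewrite mul0r addr0.
      rewrite (_ : (fun e : R => _) = (fun e : R => edge_pt A m s 0 j + e * - W m 0 j)).
        exact: K.
      by apply/funext => e; rewrite !mxE.
    exact.
  have /filter_ex[e [e0 Be]] :
      \forall e \near (0 : R)^'+, 0 < e /\ B (edge_pt A m s + e *: - W m).
    by apply: filterI; [exact: nbhs_right_gt|exact: cvg_within].
  exists (edge_pt A m s + e *: - W m); split => //; split.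
    apply/HE; rewrite addrAC dotDl dotZl dotNl WN oppr0 mulr0 addr0.
    rewrite /edge_pt addrAC dotDl dotZl AN [dot (dir A m) N]AN; ring.
  move=> /(hullW m); rewrite /= addrAC dotDl dotZl dotNl ww.
  rewrite /P /edge_pt opprD addrACA subrr add0r -scalerBl dotZl dw.
  lra.
(* A common point off the vertices is excluded by [edge_disjoint]. A common vertex must be the
   initial point of both edges, by [vertex_not_inside_edge], and vertices do not repeat. *)
have cyc_inj i j u w : (i < n)%N -> (j < n)%N -> 0 <= u < 1 -> 0 <= w < 1 ->
    edge_pt A i u = edge_pt A j w -> i = j.
  move=> ilt jlt u01 w01 e.
  suff : j = i %[mod n] by rewrite !modn_small.
  have [nz|] := pselect (off_vertices A (edge_pt A i u)).
    have u0 : 0 < u < 1.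
      have := nz i; rewrite /seen /edge_pt opprD addrA subrr sub0r oppr_eq0.
      rewrite scaler_eq0 negb_or => /andP[u0 _].
      by move: u01 => /andP[u0' ->]; rewrite lt_def u0 u0'.
    apply: (edge_disjoint n_gt1 A_cyc A_edge c_tight NN AN A_noncol u0 nz _ e).
    by lra.
  move=> /existsNP[q /negP]; rewrite negbK subr_eq0 => /eqP Aq.
  have vi : A q = A i.
    have [u0|u0] := eqVneq u 0; first by rewrite Aq u0 /edge_pt scale0r addr0.
    case: (@vertex_not_inside_edge _ n A n_gt1 A_cyc A_edge c_tight
      N NN AN A_noncol i u q) => //.
    by move: u01 => /andP[u0' ->]; rewrite lt_def u0 u0'.
  have vj : A q = A j.
    have [u0|u0] := eqVneq w 0; first by rewrite Aq e u0 /edge_pt scale0r addr0.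
    case: (@vertex_not_inside_edge _ n A n_gt1 A_cyc A_edge c_tight
      N NN AN A_noncol j w q).
      by move: w01 => /andP[u0' ->]; rewrite lt_def u0 u0'.
    by rewrite Aq.
  apply: (vertex_inj n_gt1 A_cyc A_edge c_tight NN AN A_noncol).
  by rewrite -vj.
apply: (@polygon_ngon _ n c n_gt1 c_flex c_tight H g
  (is_plane_orthonormal (A 0%N) on0) VH); last exact: polygon_order.
split; first exact: g_per.
left; split.
- move=> [Q [v col]]; apply: A_noncol; exists Q, v => k.
  have [s _ sE] := col _ (sub_hull (polygon_vertex_in n_gt1 c_flex k)).
  by exists s.
- apply: (@continuous_lipschitz _ _ n%:R) => // s t st.
  apply: (le_trans (flexible_dist c_flex _)); first by rewrite ltrD2r ltr_pM2l.
  by rewrite opprD addrACA subrr addr0 mulrBr.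
- move=> s s'; rewrite ?inE/= ?in_itv/= => s01 s'01.
  have [i [u [ilt u01 su gs]]] := g_edge s01.
  have [j [w [jlt w01 sw gs']]] := g_edge s'01.
  move=> gg; have e : edge_pt A i u = edge_pt A j w by rewrite -gs -gs'.
  have ij := cyc_inj _ _ _ _ ilt jlt u01 w01 e; subst j.
  apply: (mulfI (lt0r_neq0 nR)); rewrite su sw; congr (_ + _).
  move: e => /addrI e; apply/eqP; rewrite -subr_eq0.
  have : (u - w) *: dir A i = 0 by rewrite scalerBl e subrr.
  move/eqP; rewrite scaler_eq0 => /orP[//|/eqP d0].
  have := dir_unit n_gt1 A_cyc A_edge c_tight i.
  by rewrite d0 dot0l => /esym/eqP; rewrite oner_eq0.
- apply/seteqP; split => [_ [s _ <-]|X /boundary_edge[m [s [s01 ->]]]].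
    rewrite -/(g s) g_floor.
    have [|i [u [_ u01 _ ->]]] := g_edge (s := s - (Num.floor s)%:~R).
      by have := floor_itv s; rewrite intrD; lra.
    by apply: edge_boundary; lra.
  exists ((m%:R + s) / n%:R) => //.
  by rewrite /g [n%:R * _]mulrC divfK ?gt_eqF// addr0 c_edge.
Qed.

End Noncollinear.

Theorem theorem3p1 (R : realType) (n : nat) (f : R -> R) (c : R -> point3 R)
  (hn : (2 <= n)%N)
  (f_cont : {in `]0, +oo[, continuous f})
  (f_incr : {in `]0, +oo[ &, {homo f : x y / x < y}})
  (c_max : energy_maximizer f n c) :
  convex_unit_ngon n c.
Proof.
have [c_flex _] := c_max; have c_tight := maximizer_tight hn f_incr c_max.
have [[P [v col]]|noncol] := pselect (exists P v : point3 R, forall k, exists s,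
    vertex c k = P + s *: v); last exact: polygon_noncollinear.
(* The direction [v] of the given line is arbitrary; the first edge, of length 1, replaces it as the
   unit of the coordinate. *)
pose e := vertex c 1%N - vertex c 0%N.
have ee : dot e e = 1.
  by rewrite -nrm_sqr -distE distC (polygon_edge1 hn c_flex c_tight) expr1n.
have [s sE] := choice col.
have eE : e = (s 1%N - s 0%N) *: v.
  by rewrite /e !sE opprD addrACA subrr add0r scalerBl.
have s10 : s 1%N - s 0%N != 0.
  by apply: contra_eq_neq ee => s0; rewrite eE s0 scale0r dot0l eq_sym oner_neq0.
apply: (@polygon_collinear _ n c hn c_flex c_tight
  (fun k => (s k - s 0%N) / (s 1%N - s 0%N)) e ee) => k.
rewrite eE scalerA divfK// !sE -addrA -scalerDl; congr (_ + _ *: _); ring.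
Qed.
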